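(* Let $X$ be a Banach space and let $M$ be any one of the three quantities $M(T)=\gamma(T)$, $M(T)=\omega(T)$, $M(T)=\omega(T^* )$ (the same choice throughout). For a quantity $Q$ defined on operators, say that $X$ has property $P(M,Q)$ if there exists $C>0$ such that $M(T)\le C\,Q(T)$ for every Banach space $Y$ and every bounded linear operator $T\colon X\to Y$. Then: $P(M,\operatorname{uc})\Rightarrow P(M,\operatorname{Rcc})\Rightarrow P(M,\operatorname{Rcc}_\omega)\Rightarrow P(M,\operatorname{cc}_\rho)\Rightarrow P(M,\operatorname{cc})$; $P(M,\operatorname{Rcc})\Rightarrow P(M,\operatorname{wcc})\Rightarrow P(M,\operatorname{wcc}_\omega)\Rightarrow P(M,\operatorname{cc})$; $P(M,\operatorname{Rcc}_\omega)\Rightarrow P(M,\operatorname{wcc}_\omega)$.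
   Context: Scalars real or complex. For a bounded sequence $(y_n)$, $\operatorname{ca}((y_n))=\inf_{n}\sup\{\|y_k-y_l\|: k,l\geq n\}$. $\operatorname{uc}(T)=\sup\{\operatorname{ca}((\sum_{i=1}^n Tx_i)_n): (x_n)\subset X,\ \sup_{x^*\in B_{X^*}}\sum_n|x^*(x_n)|\le 1\}$. For a bounded subset $A$ of a Banach space $E$: $\omega(A)=\inf\{\sup_{a\in A}\operatorname{dist}(a,K):\emptyset\ne K\subset E\text{ weakly compact}\}$; $\gamma(A)=\sup\{|\lim_n\lim_m x^*_m(x_n)-\lim_m\lim_n x^*_m(x_n)|\}$ over sequences $(x_n)\subset A$, $(x_m^* )\subset B_{E^*}$ with existing iterated limits. $\gamma(T)=\gamma(T(B_X))$, $\omega(T)=\omega(T(B_X))$, $\omega(T^* )=\omega(T^*(B_{Y^*}))$ in $X^*$. The Right topology $\rho$ on $X$ is the topology of uniform convergence on weakly compact subsets of $X^*$. A weakly Cauchy sequence $(y_n)$ in $Y$ has a weak$^*$ limit $w^*\text{-}\lim y_n$ in $Y^{**}$. Define $\operatorname{cc}(T)=\sup\{\operatorname{ca}((Tx_n)): (x_n)\text{ weakly Cauchy in }B_X\}$, $\operatorname{cc}_\rho(T)=\sup\{\operatorname{ca}((Tx_n)): (x_n)\ \rho\text{-Cauchy in }B_X\}$, $\operatorname{wcc}(T)=\sup\{\operatorname{dist}(w^*\text{-}\lim Tx_n,Y): (x_n)\text{ weakly Cauchy in }B_X\}$, $\operatorname{wcc}_\omega(T)=\sup\{\omega(\{Tx_n:n\in\mathbb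 N\}): (x_n)\text{ weakly Cauchy in }B_X\}$, $\operatorname{Rcc}(T)=\sup\{\operatorname{dist}(w^*\text{-}\lim Tx_n,Y): (x_n)\ \rho\text{-Cauchy in }B_X\}$, $\operatorname{Rcc}_\omega(T)=\sup\{\omega(\{Tx_n:n\in\mathbb N\}): (x_n)\ \rho\text{-Cauchy in }B_X\}$. (In the paper's terminology these properties are the quantitative versions of (V), (RD), (D), (SR), (RDP).) *)

(* Defs.v *)
(* Scalars: K = R (real) or K = R[i] (complex),
   R : realType.  Norms of scalars/vectors live in K; [nrm] converts those (real,
   nonnegative) values into R (id for K = R, complex.Re for K = R[i]). *)
From HB Require Import structures.
From mathcomp Require Import all_boot all_order all_algebra.
From mathcomp Require Import all_classical all_reals all_analysis.
From mathcomp Require Import complex.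
Import Order.TTheory GRing.Theory Num.Theory.
Import numFieldNormedType.Exports numFieldTopology.Exports.

Set Implicit Arguments.
Unset Strict Implicit.
Unset Printing Implicit Defensive.

Local Open Scope classical_set_scope.
Local Open Scope ring_scope.

Section BanachQuantities.
Variables (R : realType) (K : numFieldType) (nrm : K -> R).

Definition unit_ball (V : normedModType K) : set V := [set x | nrm `|x| <= 1].

Definition lin_functional (V : normedModType K) (f : V -> K) : Prop :=
  forall (a : K) (x y : V), f (a *: x + y) = a * f x + f y.

Definition is_dual (V : normedModType K) (f : V -> K) : Prop :=
  lin_functional f /\ exists c : R, forall x, nrm `|f x| <= c * nrm `|x|.

Definition dual_ball (V : normedModType K) (f : V -> K) : Prop :=
  lin_functional f /\ forall x, nrm `|f x| <= nrm `|x|.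

Definition dnorm (V : normedModType K) (f : V -> K) : \bar R :=
  ereal_sup [set (nrm `|f x|)%:E | x in @unit_ball V].

(** elements of V^{**} viewed as functionals on V^{*} (only their values on
    elements of V^{*} matter) *)
Definition is_bidual (V : normedModType K) (Phi : (V -> K) -> K) : Prop :=
  (forall (a : K) (f g : V -> K), is_dual f -> is_dual g ->
     Phi (fun x => a * f x + g x) = a * Phi f + Phi g) /\
  exists c : R, forall f, is_dual f -> ((nrm `|Phi f|)%:E <= c%:E * dnorm f)%E.

(** compactness for the initial (weak) topology on S induced by the family D
    of scalar functions: the initial topology of s |-> (f |-> f s) into the
    pointwise (product) topology *)
Definition wcompact_wrt (S : choiceType) (D : set (S -> K)) (A : set S) : Prop :=
  @compact (initial_topology
              (fun s : S => (fun f : {f | D f} => sval f s) : {ptws {f | D f} -> K})) A.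

Definition wcompact (V : normedModType K) (A : set V) : Prop :=
  wcompact_wrt (@is_dual V) A.

Definition wcompact_dual (V : normedModType K) (L : set (V -> K)) : Prop :=
  L `<=` @is_dual V /\ wcompact_wrt (@is_bidual V) L.

Definition omega_gen (S : Type) (WC : set S -> Prop) (d : S -> S -> \bar R)
    (A : set S) : \bar R :=
  ereal_inf [set ereal_sup [set ereal_inf [set d a k | k in C] | a in A]
            | C in [set C : set S | C !=set0 /\ WC C]].

Definition omega (V : normedModType K) (A : set V) : \bar R :=
  omega_gen (@wcompact V) (fun a k => (nrm `|a - k|)%:E) A.

Definition omega_dual (V : normedModType K) (A : set (V -> K)) : \bar R :=
  omega_gen (@wcompact_dual V) (fun f g => dnorm (fun x => f x - g x)) A.

Definition gamma_set (V : normedModType K) (A : set V) : \bar R :=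
  ereal_sup [set e | exists (x : nat -> V) (xs : nat -> V -> K) (a b : nat -> K)
                            (L1 L2 : K),
    (forall n, A (x n)) /\ (forall m, dual_ball (xs m)) /\
    (forall n, (fun m => xs m (x n)) @ \oo --> a n) /\ a @ \oo --> L1 /\
    (forall m, (fun n => xs m (x n)) @ \oo --> b m) /\ b @ \oo --> L2 /\
    e = (nrm `|L1 - L2|)%:E].

Definition ca (V : normedModType K) (y : nat -> V) : \bar R :=
  ereal_inf [set ereal_sup [set (nrm `|y kl.1 - y kl.2|)%:E
                           | kl in [set kl : nat * nat | (n <= kl.1)%N /\ (n <= kl.2)%N]]
            | n in [set: nat]].

Definition wuc_ball (X : normedModType K) (x : nat -> X) : Prop :=
  forall xs : X -> K, dual_ball xs -> forall N : nat, \sum_(i < N) nrm `|xs (x i)| <= 1.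

Definition wcauchy (V : normedModType K) (x : nat -> V) : Prop :=
  forall f : V -> K, is_dual f -> cauchy ((fun n => f (x n)) @ \oo).

(** Cauchy sequences for the Right topology rho (uniform convergence on
    weakly compact subsets of X^{*}) *)
Definition rho_cauchy (X : normedModType K) (x : nat -> X) : Prop :=
  forall L : set (X -> K), wcompact_dual L ->
  forall e : R, 0 < e -> exists N : nat, forall n m : nat, (N <= n)%N -> (N <= m)%N ->
    forall f, L f -> nrm `|f (x n) - f (x m)| <= e.

(** dist(w*-lim y_n, Y) in Y^{**} for a weakly Cauchy sequence (y_n) in Y:
    inf_{y0 in Y} sup_{y^{*} in B_{Y^{*}}} |lim_n y^{*}(y_n) - y^{*}(y0)| *)
Definition wstar_dist (Y : normedModType K) (y : nat -> Y) : \bar R :=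
  ereal_inf [set ereal_sup [set e | exists (ys : Y -> K) (l : K),
                   [/\ dual_ball ys, (fun n => ys (y n)) @ \oo --> l
                     & e = (nrm `|l - ys y0|)%:E]]
            | y0 in [set: Y]].

Section Operator.
Variables (X Y : normedModType K) (T : X -> Y).

Definition ball_seq (x : nat -> X) : Prop := forall n, @unit_ball X (x n).

Definition gammaT : \bar R := gamma_set (T @` @unit_ball X).
Definition omegaT : \bar R := omega (T @` @unit_ball X).
Definition omega_adjT : \bar R :=
  omega_dual [set (fun x => ys (T x)) | ys in @dual_ball Y].

Definition uc : \bar R :=
  ereal_sup [set ca (fun n => \sum_(i < n.+1) T (x i)) | x in @wuc_ball X].

Definition cc : \bar R :=
  ereal_sup [set ca (T \o x) | x in [set x | ball_seq x /\ wcauchy x]].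
Definition cc_rho : \bar R :=
  ereal_sup [set ca (T \o x) | x in [set x | ball_seq x /\ rho_cauchy x]].
Definition wcc : \bar R :=
  ereal_sup [set wstar_dist (T \o x) | x in [set x | ball_seq x /\ wcauchy x]].
Definition wcc_omega : \bar R :=
  ereal_sup [set omega (range (T \o x)) | x in [set x | ball_seq x /\ wcauchy x]].
Definition Rcc : \bar R :=
  ereal_sup [set wstar_dist (T \o x) | x in [set x | ball_seq x /\ rho_cauchy x]].
Definition Rcc_omega : \bar R :=
  ereal_sup [set omega (range (T \o x)) | x in [set x | ball_seq x /\ rho_cauchy x]].

End Operator.

Definition quantity (X : completeNormedModType K) :=
  forall Y : completeNormedModType K, (X -> Y) -> \bar R.

Definition propP (X : completeNormedModType K) (M Q : quantity X) : Prop :=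
  exists C : R, 0 < C /\
    forall (Y : completeNormedModType K) (T : {linear X -> Y}), continuous T ->
      (M Y T <= C%:E * Q Y T)%E.

Inductive Mkind := M_gamma | M_omega | M_omega_adj.

Definition Mq (m : Mkind) (X : completeNormedModType K) : quantity X :=
  match m with
  | M_gamma => fun Y T => @gammaT X Y T
  | M_omega => fun Y T => @omegaT X Y T
  | M_omega_adj => fun Y T => @omega_adjT X Y T
  end.

Definition theorem5p5_statement : Prop :=
  forall (m : Mkind) (X : completeNormedModType K),
  let P := fun Q : quantity X => propP (@Mq m X) Q in
  (P (fun Y T => @uc X Y T) -> P (fun Y T => @Rcc X Y T)) /\
  (P (fun Y T => @Rcc X Y T) -> P (fun Y T => @Rcc_omega X Y T)) /\
  (P (fun Y T => @Rcc_omega X Y T) -> P (fun Y T => @cc_rho X Y T)) /\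
  (P (fun Y T => @cc_rho X Y T) -> P (fun Y T => @cc X Y T)) /\
  (P (fun Y T => @Rcc X Y T) -> P (fun Y T => @wcc X Y T)) /\
  (P (fun Y T => @wcc X Y T) -> P (fun Y T => @wcc_omega X Y T)) /\
  (P (fun Y T => @wcc_omega X Y T) -> P (fun Y T => @cc X Y T)) /\
  (P (fun Y T => @Rcc_omega X Y T) -> P (fun Y T => @wcc_omega X Y T)).

End BanachQuantities.

(* Main.v *)
(* All implications except the first hold because the quantities are comparable
   pointwise with constant 1: rho-Cauchy sequences are weakly Cauchy, a weak
   cluster point in [K] of a sequence approximating [(y_n)] shows that
   dist(w*-lim y_n, Y) <= omega({y_n}), and finite sets being weakly compact,
   omega({y_n}) <= ca(y_n).

   For the first one we show uc(T) <= 16 Rcc(T).  If the images of the partial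
   sums of a weakly unconditionally Cauchy series oscillate by more than c, some
   disjoint blocks u_k have |T u_k| > c; let w_k in the dual ball norm T u_k.  A
   gliding hump makes the matrix w_p(T u_q), minus the limits of its columns,
   essentially diagonal along a subsequence.  The partial sums of every second
   block are rho-Cauchy (again by a gliding hump, now along elements of a weakly
   compact subset of the dual), and the differences w_p - w_q keep their images
   away from Y. *)

Require Import Defs.
From HB Require Import structures.
From mathcomp Require Import all_boot all_order all_algebra.
From mathcomp Require Import all_classical all_reals all_analysis.
From mathcomp Require Import complex.
From mathcomp Require Import ring lra.
Import Order.TTheory GRing.Theory Num.Theory.
Import numFieldNormedType.Exports numFieldTopology.Exports.

Set Implicit Arguments.
Unset Strict Implicit.
Unset Printing Implicit Defensive.

Local Open Scope classical_set_scope.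
Local Open Scope ring_scope.

(** * The Hahn-Banach theorem *)

Lemma inf_leD (R : realType) (A B C : set R) :
  A !=set0 -> B !=set0 -> has_lbound C ->
  (forall a b, A a -> B b -> exists2 c, C c & c <= a + b) ->
  inf C <= inf A + inf B.
Proof.
move=> A0 B0 lC ABC; rewrite -lerBlDr; apply: lb_le_inf => // a Aa.
rewrite lerBlDr -lerBlDl; apply: lb_le_inf => // b Bb.
rewrite lerBlDl; have [c Cc cab] := ABC a b Aa Bb.
exact: le_trans (ge_inf lC Cc) cab.
Qed.

Lemma inf_leM (R : realType) (A C : set R) (r : R) :
  0 < r -> A !=set0 -> has_lbound C ->
  (forall a, A a -> exists2 c, C c & c <= r * a) -> inf C <= r * inf A.
Proof.
move=> r0 A0 lC AC; rewrite -ler_pdivrMl//; apply: lb_le_inf => // a Aa.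
rewrite ler_pdivrMl//; have [c Cc ca] := AC a Aa.
exact: le_trans (ge_inf lC Cc) ca.
Qed.

Section RealHahnBanach.
Context {R : realType} {K : fieldType} (iota : {rmorphism R -> K}).
Context {V : lmodType K}.
Implicit Types (p q : V -> R) (v x y : V).

Definition sublinear q :=
  (forall x y, q (x + y) <= q x + q y) /\
  (forall r x, 0 < r -> q (iota r *: x) <= r * q x).

Lemma sublinear0 q : sublinear q -> q 0 = 0.
Proof.
move=> [_ qM]; apply/eqP; rewrite eq_le; apply/andP; split.
  have := qM 2^-1 0; rewrite scaler0 => /(_ _); lra.
have := qM 2 0; rewrite scaler0 => /(_ _); lra.
Qed.

Lemma sublinearZ q t x : sublinear q -> 0 <= t -> q (iota t *: x) = t * q x.
Proof.
move=> sq; rewrite le_eqVlt => /predU1P[<-|t0].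
  by rewrite rmorph0 scale0r mul0r sublinear0.
apply/eqP; rewrite eq_le sq.2//= -ler_pdivlMl//.
rewrite -[X in q X <= _](_ : iota t^-1 *: (iota t *: x) = x).
  by rewrite sq.2// invr_gt0.
by rewrite scalerA -rmorphM mulVf ?gt_eqF// rmorph1 scale1r.
Qed.

Lemma sublinear_geN q x : sublinear q -> - q (- x) <= q x.
Proof.
by move=> sq; have := sq.1 x (- x); rewrite subrr sublinear0//; lra.
Qed.

(** Of two members of the chain the smaller one serves both summands, which gives subadditivity of
    the infimum; [- p (- x)] bounds all values at [x] from below and keeps the infimum finite. *)
Lemma chain_inf_sublinear p (A : set (V -> R)) : A !=set0 ->
  (forall q, A q -> sublinear q /\ (forall x, q x <= p x)) ->
  (forall q q', A q -> A q' ->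
     (forall x, q x <= q' x) \/ (forall x, q' x <= q x)) ->
  sublinear (fun x => inf [set q x | q in A]) /\
  (forall q x, A q -> inf [set q x | q in A] <= q x).
Proof.
move=> [q0 Aq0] Asub Atot.
have lA x : has_lbound [set q x | q in A].
  exists (- p (- x)) => _ [q Aq <-].
  have [sq qp] := Asub q Aq.
  by apply: le_trans (sublinear_geN x sq); rewrite lerN2.
have nA x : [set q x | q in A] !=set0 by exists (q0 x), q0.
split; last by move=> q x Aq; apply: ge_inf => //; exists q.
split => [x y|r x r0].
  apply: inf_leD => // _ _ [q Aq <-] [q' Aq' <-].
  have [qq'|q'q] := Atot q q' Aq Aq'.
    exists (q (x + y)); first by exists q.
    by rewrite (le_trans ((Asub q Aq).1.1 x y))// lerD2l.
  exists (q' (x + y)); first by exists q'.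
  by rewrite (le_trans ((Asub q' Aq').1.1 x y))// lerD2r.
apply: inf_leM => // _ [q Aq <-]; exists (q (iota r *: x)); first by exists q.
exact: (Asub q Aq).1.2.
Qed.

(** For sublinear [q] and [t > 0] the expression is the difference quotient of [q] at [v] in
    direction [x] with step [1 / t], so the infimum is the one-sided directional derivative. *)
Definition tangent q v x :=
  inf [set q (x + iota t *: v) - t * q v | t in [set t | 0 <= t]].

Lemma tangent_lbound q v x : sublinear q ->
  has_lbound [set q (x + iota t *: v) - t * q v | t in [set t | 0 <= t]].
Proof.
move=> sq; exists (- q (- x)) => _ [t /= t0 <-].
rewrite -sublinearZ//.
have := sq.1 (x + iota t *: v) (- x); rewrite addrAC subrr add0r; lra.
Qed.

Lemma tangent_le q v x t : sublinear q -> 0 <= t ->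
  tangent q v x <= q (x + iota t *: v) - t * q v.
Proof. by move=> sq t0; apply: ge_inf; [exact: tangent_lbound | exists t]. Qed.

Lemma tangent_sublinear q v : sublinear q -> sublinear (tangent q v).
Proof.
move=> sq.
have n0 x : [set q (x + iota t *: v) - t * q v | t in [set t | 0 <= t]] !=set0.
  by exists (q (x + iota 0 *: v) - 0 * q v), 0 => /=.
split=> [x y|r x r0].
  apply: inf_leD => //; first exact: tangent_lbound.
  move=> _ _ [t /= t0 <-] [u /= u0 <-].
  exists (q (x + y + iota (t + u) *: v) - (t + u) * q v).
    by exists (t + u) => //=; rewrite addr_ge0.
  have := sq.1 (x + iota t *: v) (y + iota u *: v).
  rewrite addrACA -scalerDl -rmorphD; lra.
apply: inf_leM => //; first exact: tangent_lbound.
move=> _ [t /= t0 <-].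
exists (q (iota r *: x + iota (r * t) *: v) - (r * t) * q v).
  by exists (r * t) => //=; rewrite mulr_ge0// ltW.
rewrite rmorphM -scalerA -scalerDr mulrBr mulrA lerD2r.
exact: sq.2.
Qed.

(* Minimality forces [tangent q v = q] for every [v], which is additivity. *)
Lemma minimal_sublinear q : sublinear q ->
  (forall q', sublinear q' -> (forall x, q' x <= q x) -> q' = q) ->
  (forall x y, q (x + y) = q x + q y) /\
  (forall r x, q (iota r *: x) = r * q x).
Proof.
move=> sq qmin.
have qD x y : q (x + y) = q x + q y.
  apply/eqP; rewrite eq_le sq.1/=.
  have tq : tangent q y = q.
    apply: qmin => [|z]; first exact: tangent_sublinear.
    by have := tangent_le y z sq (lexx 0); rewrite rmorph0 scale0r addr0; lra.
  by have := tangent_le y x sq ler01; rewrite rmorph1 scale1r tq; lra.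
split=> // r x; have [r0|r0] := leP 0 r; first exact: sublinearZ.
have qN z : q (- z) = - q z.
  by have := qD z (- z); rewrite subrr sublinear0//; lra.
by rewrite -[r]opprK rmorphN scaleNr qN sublinearZ ?oppr_ge0 ?ltW// [RHS]mulNr.
Qed.

(** Zorn's lemma runs over the sublinear functions below the tangent of [p] at [v], not over
    extensions from subspaces. A minimal one is real-linear, and the tangent is at most [- p v] at
    [- v], which forces the value [p v] at [v]. *)
Lemma real_hahn_banach p v : sublinear p ->
  exists f : V -> R,
    [/\ forall x y, f (x + y) = f x + f y,
        forall r x, f (iota r *: x) = r * f x,
        forall x, f x <= p x & f v = p v].
Proof.
move=> sp; set pv := tangent p v.
have spv : sublinear pv by exact: tangent_sublinear.
pose P q := sublinear q /\ forall x, q x <= pv x.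
pose S := {q | P q}.
(* The order is reversed, so that a maximal element is a minimal sublinear function. *)
pose below (q q' : S) := `[< forall x, sval q' x <= sval q x >].
have [||||q qmin] := @Zorn S below.
- by move=> q; apply/asboolP.
- move=> q q' q'' /asboolP qq' /asboolP q'q''; apply/asboolP => x.
  exact: le_trans (q'q'' x) (qq' x).
- move=> [q Hq] [q' Hq'] /asboolP/= qq' /asboolP/= q'q.
  have qE : q = q' by apply/funext => x; apply/eqP; rewrite eq_le qq' q'q.
  by move: Hq; rewrite qE => Hq; congr exist; exact: Prop_irrelevance.
- move=> A Atot; have [->|/set0P[q0 Aq0]] := eqVneq A set0.
    by exists (exist P pv (conj spv (fun x => lexx _))).
  pose B := [set sval q | q in A].
  have [||| sB leB] := @chain_inf_sublinear pv B.
  + by exists (sval q0), q0.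
  + by move=> _ [q Aq <-]; exact: svalP q.
  + move=> _ _ [q Aq <-] [q' Aq' <-].
    have [/asboolP ?|/asboolP ?] := Atot q q' Aq Aq'; first by right.
    by left.
  have Bpv x : inf [set q x | q in B] <= pv x.
    apply: le_trans ((svalP q0).2 x); apply: leB.
    by exists q0.
  exists (exist P _ (conj sB Bpv)) => q Aq; apply/asboolP => x /=.
  by apply: leB; exists q.
have [sq qpv] := svalP q.
have [qD qZ] : (forall x y, sval q (x + y) = sval q x + sval q y) /\
    (forall r x, sval q (iota r *: x) = r * sval q x).
  apply: minimal_sublinear => // q' sq' q'q.
  have q'pv x : q' x <= pv x := le_trans (q'q x) (qpv x).
  by rewrite -(qmin (exist P q' (conj sq' q'pv)))//; apply/asboolP.
have qp x : sval q x <= p x.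
  apply: le_trans (qpv x) _.
  by have := tangent_le v x sp (lexx 0); rewrite rmorph0 scale0r addr0 -/pv; lra.
exists (sval q); split=> //; apply/eqP; rewrite eq_le qp/=.
have := tangent_le v (- v) sp ler01.
rewrite rmorph1 scale1r addNr sublinear0// -/pv => pvN.
have := qZ (-1) v; rewrite rmorphN rmorph1 scaleN1r mulN1r => qN.
have := qpv (- v); lra.
Qed.

End RealHahnBanach.

(** * Gliding humps *)

Section GlidingHump.
Context {R : realType}.
Implicit Types (g : nat -> R) (phi : nat -> nat).

Lemma bounded_series_tail g B : (forall j, 0 <= g j) ->
  (forall N, \sum_(0 <= j < N) g j <= B) ->
  forall e, 0 < e -> exists k0, forall k N, (k0 <= k)%N ->
    \sum_(k <= j < N) g j <= e.
Proof.
move=> g0 gB e e0.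
pose S := [set \sum_(0 <= j < N) g j | N in [set: nat]].
have supS : has_sup S.
  by split; [exists (\sum_(0 <= j < 0) g j), 0%N | exists B => _ [N _ <-]].
have [_ [n _ <-] Sn] := sup_adherent e0 supS.
exists n => k N nk; have [Nk|kN] := leqP N k; first by rewrite big_geq// ltW.
have : \sum_(0 <= j < N) g j <= sup S by apply: ub_le_sup; [exact: supS.2 | exists N].
rewrite (@big_cat_nat _ _ _ k)//= ?(ltnW kN)//.
rewrite (@big_cat_nat _ _ _ n 0 k)//=.
have : 0 <= \sum_(n <= j < k) g j by apply: sumr_ge0.
lra.
Qed.

Lemma bounded_series_term g B : (forall j, 0 <= g j) ->
  (forall N, \sum_(0 <= j < N) g j <= B) ->
  forall e, 0 < e -> exists k0, forall k, (k0 <= k)%N -> g k <= e.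
Proof.
move=> g0 gB e e0; have [k0 k0P] := bounded_series_tail g0 gB e0.
by exists k0 => k kk; have := k0P k k.+1 kk; rewrite big_nat1.
Qed.

Lemma ltn_iter_leq phi : (forall p, phi p < phi p.+1)%N ->
  forall p q, (p <= q)%N -> (phi p <= phi q)%N.
Proof.
move=> phiS p; elim=> [|q IH]; first by rewrite leqn0 => /eqP ->.
rewrite leq_eqVlt => /predU1P[->//|/IH]; move/leq_trans; apply.
exact: ltnW.
Qed.

Lemma ltn_iter_ltn phi : (forall p, phi p < phi p.+1)%N ->
  forall p q, (p < q)%N -> (phi p < phi q)%N.
Proof.
by move=> phiS p q pq; apply: leq_trans (phiS p) _; exact: ltn_iter_leq.
Qed.

Lemma ltn_iter_ge phi : (forall p, phi p < phi p.+1)%N ->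
  forall p, (p <= phi p)%N.
Proof. by move=> phiS; elim=> // p IH; exact: leq_ltn_trans (phiS p). Qed.

Lemma ler_sum_subseq g phi a b m : (forall j, 0 <= g j) ->
  (forall p, phi p < phi p.+1)%N -> (forall l, (l < b)%N -> (phi l < m)%N) ->
  \sum_(a <= l < b) g (phi l) <= \sum_(phi a <= j < m) g j.
Proof.
move=> g0 phiS; elim: b m => [|b IH] m phim.
  by rewrite big_geq// sumr_ge0.
have [ba|ab] := ltnP b a; first by rewrite big_geq// sumr_ge0.
have bm := phim b (ltnSn b).
have ab' := ltn_iter_leq phiS ab.
rewrite big_nat_recr//= (big_cat_nat (leqW ab') bm)/=.
rewrite big_nat_recr//=.
have := IH (phi b) (ltn_iter_ltn phiS ^~ b).
have : 0 <= \sum_((phi b).+1 <= j < m) g j by exact: sumr_ge0.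
lra.
Qed.

(** After [m] comes a [k > m] whose row is below [e / 2 / (m + 1)] in the columns [0..m], and beyond
    which row [m] sums to at most [e / 2]. Each row thus has at most [e / 2] on either side of the
    diagonal. Columns only need to be small for arbitrarily late rows, as happens near a cluster
    point. *)
Lemma gliding_hump (beta : nat -> nat -> R) (N0 : nat) (e : R) :
  (forall i j, 0 <= beta i j) ->
  (forall i, exists B, forall N, \sum_(0 <= j < N) beta i j <= B) ->
  (forall J N d, 0 < d -> exists2 k, (N <= k)%N &
     forall j, (j < J)%N -> beta k j < d) ->
  0 < e ->
  exists phi,
    [/\ forall p, (N0 <= phi p)%N, forall p, (phi p < phi p.+1)%N,
        forall p N, \sum_(0 <= l < N | l != p) beta (phi p) (phi l) <= e &
        forall j d, 0 < d -> exists P, forall p, (P <= p)%N ->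
          beta (phi p) j < d].
Proof.
move=> b0 rows cols e0.
pose next m k := [/\ (m < k)%N,
  forall j, (j < m.+1)%N -> beta k j < e / 2 / m.+1%:R &
  forall N, \sum_(k <= j < N) beta m j <= e / 2].
have nextP m : exists k, next m k.
  have [B mB] := rows m.
  have e2 : 0 < e / 2 by lra.
  have [k0 k0P] := bounded_series_tail (b0 m) mB e2.
  have d0 : 0 < e / 2 / m.+1%:R by rewrite divr_gt0.
  have [k kk kP] := cols m.+1 (maxn k0 m.+1) _ d0.
  move: kk; rewrite geq_max => /andP[k0k mk].
  by exists k; split=> // N; exact: k0P.
have [f fP] := choice nextP.
pose phi p := iter p f N0.
have phiS p : (phi p < phi p.+1)%N by case: (fP (phi p)).
have phi_small p j : (j < (phi p).+1)%N ->
    beta (phi p.+1) j < e / 2 / (phi p).+1%:R by case: (fP (phi p)) => _ + _; apply.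
exists phi; split=> //.
- by move=> p; exact: (@ltn_iter_leq _ phiS 0).
- have before p : \sum_(0 <= l < p) beta (phi p) (phi l) <= e / 2.
    case: p => [|p]; first by rewrite big_geq//; lra.
    apply: le_trans (@ler_sum_subseq _ phi 0 p.+1 (phi p).+1 _ _ _) _ => //.
      by move=> l; rewrite ltnS => lp; rewrite ltnS; exact: ltn_iter_leq.
    rewrite big_nat; apply: (@le_trans _ _ (\sum_(phi 0%N <= j < (phi p).+1)
        e / 2 / (phi p).+1%:R)).
      rewrite [leRHS]big_nat; apply: ler_sum => j /andP[_ jp].
      exact/ltW/phi_small.
    rewrite sumr_const_nat -[leLHS]mulr_natr -[leLHS]mulrA ler_piMr//; first by lra.
    by rewrite ler_pdivrMl// mulr1 ler_nat leq_subr.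
  have after p N : \sum_(p.+1 <= l < N) beta (phi p) (phi l) <= e / 2.
    apply: le_trans (@ler_sum_subseq _ phi p.+1 N (phi N) _ _ _) _ => //.
      by move=> l; exact: ltn_iter_ltn.
    by case: (fP (phi p)).
  have drop_cond p m N : \sum_(m <= l < N | l != p) beta (phi p) (phi l) <=
      \sum_(m <= l < N) beta (phi p) (phi l).
    by rewrite big_mkcond/=; apply: ler_sum => l _; case: ifP.
  move=> p N; have [Np|pN] := leqP N p.
    apply: le_trans (drop_cond p 0%N N) _.
    have : 0 <= \sum_(N <= l < p) beta (phi p) (phi l) by exact: sumr_ge0.
    have := before p; rewrite (big_cat_nat (leq0n N) Np)/=; lra.
  rewrite (big_cat_nat (leq0n p) (ltnW pN))/= [X in _ + X]big_ltn_cond// eqxx/=.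
  have := le_trans (drop_cond p 0%N p) (before p).
  have := le_trans (drop_cond p p.+1 N) (after p N).
  lra.
- move=> j d d0.
  have [n nP] : exists n : nat, e / d < n%:R.
    by exists (Num.Def.archi_bound (e / d)); rewrite archi_boundP// divr_ge0// ltW.
  (* The bound on row [phi p.+1] is valid up to column [phi p], which is at least [p]: [p >= j]
     brings column [j] under it, and [p >= n] makes it smaller than [d]. *)
  exists (maxn j n).+1 => -[//|p]; rewrite ltnS geq_max => /andP[jp np].
  have pp := ltn_iter_ge phiS p.
  apply: lt_trans (phi_small p j _) _; first by rewrite ltnS (leq_trans jp).
  rewrite ltr_pdivrMr//.
  have : e < d * (phi p).+1%:R.
    rewrite -ltr_pdivrMl// mulrC (lt_le_trans nP)// ler_nat ltnW//.
    by rewrite ltnS (leq_trans np).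
  lra.
Qed.

End GlidingHump.

(** * Normed spaces over the real or complex numbers *)

Lemma ptws_eval_continuous (I : Type) (T : topologicalType) (i : I) :
  continuous (fun h : {ptws I -> T} => h i).
Proof.
move=> f U fU; have /cvg_sup/(_ i) := @cvg_id _ (nbhs (f : {ptws I -> T})).
move=> /(_ _ (@initial_continuous _ _ (fun h : I -> T => h i) f U fU)).
exact.
Qed.

Lemma compact_seq_cluster (T : topologicalType) (A : set T) (x : nat -> T) :
  compact A -> (forall n, A (x n)) ->
  exists l, A l /\ forall U, nbhs l U -> forall M, exists2 k, (M <= k)%N & U (x k).
Proof.
move=> cA Ax; have [|l [Al xl]] := cA (x @ \oo) _.
  by exists 0%N => // n _; exact: Ax.
exists l; split=> // U lU M.
have xM : (x @ \oo) [set x k | k in [set k | (M <= k)%N]].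
  by exists M => // k Mk; exists k.
by have [_ [[k Mk <-] Uxk]] := xl _ _ xM lU; exists k.
Qed.

(* The axioms shared by the scalar fields R and R[i]: [nrm] is the identity,
   resp. the real part, and [iota] the embedding of the reals. *)
Record scalar_field (R : realType) (K : numFieldType) (nrm : K -> R)
    (iota : {rmorphism R -> K}) : Prop := ScalarField {
  scalar_nrmD : {morph nrm : x y / x + y};
  scalar_nrm_ge0 : forall x, 0 <= x -> 0 <= nrm x;
  scalar_iotaK : forall r, nrm (iota r) = r;
  scalar_nrmK : forall x, 0 <= x -> iota (nrm x) = x;
  scalar_iota_ge0 : forall r, 0 <= r -> 0 <= iota r;
  scalar_ball_compact : forall c, exists2 A : set K, compact A &
    forall z, nrm `|z| <= c -> A z;
  scalar_hahn_banach : forall (V : normedModType K) (p : V -> R),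
    (forall x y, p (x + y) <= p x + p y) ->
    (forall a x, p (a *: x) <= nrm `|a| * p x) ->
    forall v, exists f, [/\ lin_functional f, forall x, nrm `|f x| <= p x
                          & nrm `|f v| = p v] }.

Section ScalarField.
Context {R : realType} {K : numFieldType} {nrm : K -> R}.
Context {iota : {rmorphism R -> K}} (SF : scalar_field nrm iota).

Lemma nrm0 : nrm 0 = 0.
Proof. by apply: (addrI (nrm 0)); rewrite -(scalar_nrmD SF) !addr0. Qed.

Lemma nrmN x : nrm (- x) = - nrm x.
Proof. by apply/eqP; rewrite -addr_eq0 -(scalar_nrmD SF) addNr nrm0. Qed.

Lemma ler_nrm x y : x <= y -> nrm x <= nrm y.
Proof.
rewrite -subr_ge0 => /(scalar_nrm_ge0 SF).
by rewrite (scalar_nrmD SF) nrmN subr_ge0.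
Qed.

Lemma nrmM x y : 0 <= x -> 0 <= y -> nrm (x * y) = nrm x * nrm y.
Proof.
move=> x0 y0; rewrite -[in LHS](scalar_nrmK SF x0) -[in LHS](scalar_nrmK SF y0).
by rewrite -rmorphM (scalar_iotaK SF).
Qed.

Lemma iota_gt0 r : 0 < r -> 0 < iota r.
Proof.
move=> r0; rewrite lt0r (scalar_iota_ge0 SF (ltW r0)) andbT fmorph_eq0.
by rewrite gt_eqF.
Qed.

(** The order of [K] may be partial; a nonnegative [x] is the image of the real [nrm x], so the
    comparison takes place among reals. *)
Lemma ltr_nrm x y : 0 <= x -> (x < iota y) = (nrm x < y).
Proof.
move=> x0; apply/idP/idP => [xy|].
  rewrite ltNge; apply/negP => yx.
  have : iota y <= x.
    by rewrite -(scalar_nrmK SF x0) -subr_ge0 -rmorphB (scalar_iota_ge0 SF)// subr_ge0.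
  by rewrite lt_geF.
move=> xy; rewrite -subr_gt0 -[X in _ - X](scalar_nrmK SF x0) -rmorphB.
by rewrite iota_gt0// subr_gt0.
Qed.

Lemma nrm_gt0 x : 0 < x -> 0 < nrm x.
Proof.
move=> x0; rewrite lt0r (scalar_nrm_ge0 SF (ltW x0)) andbT.
apply: contraTneq (x0) => nx0.
by rewrite -(scalar_nrmK SF (ltW x0)) nx0 rmorph0 ltxx.
Qed.

Lemma nrm_norm_ge0 (V : normedZmodType K) (x : V) : 0 <= nrm `|x|.
Proof. by rewrite (scalar_nrm_ge0 SF). Qed.

Lemma nrm_norm0 (V : normedZmodType K) : nrm `|0 : V| = 0.
Proof. by rewrite normr0 nrm0. Qed.

Lemma ler_nrmD (V : normedZmodType K) (x y : V) :
  nrm `|x + y| <= nrm `|x| + nrm `|y|.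
Proof. by rewrite -(scalar_nrmD SF) ler_nrm// ler_normD. Qed.

Lemma nrm_normN (V : normedZmodType K) (x : V) : nrm `|- x| = nrm `|x|.
Proof. by rewrite normrN. Qed.

Lemma nrm_distC (V : normedZmodType K) (x y : V) : nrm `|x - y| = nrm `|y - x|.
Proof. by rewrite distrC. Qed.

Lemma ler_nrmB (V : normedZmodType K) (x y : V) :
  nrm `|x - y| <= nrm `|x| + nrm `|y|.
Proof. by rewrite (le_trans (ler_nrmD _ _))// nrm_normN. Qed.

Lemma ler_nrm_dist (V : normedZmodType K) (x y z : V) :
  nrm `|x - z| <= nrm `|x - y| + nrm `|y - z|.
Proof. by rewrite -[x - z](subrKA y) ler_nrmD. Qed.

Lemma ler_nrm_sum (V : normedZmodType K) (I : Type) (r : seq I) (P : pred I)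
    (F : I -> V) :
  nrm `|\sum_(i <- r | P i) F i| <= \sum_(i <- r | P i) nrm `|F i|.
Proof.
elim/big_ind2: _ => [|x1 x2 y1 y2 h1 h2|//]; first by rewrite nrm_norm0.
by rewrite (le_trans (ler_nrmD _ _))// lerD.
Qed.

Lemma nrm_normM (x y : K) : nrm `|x * y| = nrm `|x| * nrm `|y|.
Proof. by rewrite normrM nrmM. Qed.

Lemma nrm_normZ (V : normedModType K) (a : K) (x : V) :
  nrm `|a *: x| = nrm `|a| * nrm `|x|.
Proof. by rewrite normrZ nrmM. Qed.

Lemma nrm_iota r : 0 <= r -> nrm `|iota r| = r.
Proof. by move=> r0; rewrite ger0_norm ?(scalar_iota_ge0 SF)// (scalar_iotaK SF). Qed.

Lemma nrm_norm_eq0 (V : normedZmodType K) (x : V) : nrm `|x| = 0 -> x = 0.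
Proof.
by move=> x0; apply/eqP; rewrite -normr_eq0 -(scalar_nrmK SF (normr_ge0 x)) x0 rmorph0.
Qed.

Lemma cvg_nrmP (u : nat -> K) (l : K) :
  u @ \oo --> l <-> forall e, 0 < e -> exists n, forall m, (n <= m)%N ->
    nrm `|u m - l| < e.
Proof.
split=> [/cvgrPdist_lt ul e e0|ul].
  have [n _ nP] := ul _ (iota_gt0 e0); exists n => m /nP /=.
  by rewrite ltr_nrm// distrC.
apply/cvgrPdist_lt => e e0.
have [n nP] := ul _ (nrm_gt0 e0).
exists n => // m /nP /=.
by rewrite -ltr_nrm// (scalar_nrmK SF (ltW e0)) distrC.
Qed.

Lemma nbhs_nrm (l : K) e : 0 < e -> nbhs l [set z | nrm `|z - l| < e].
Proof.
move=> e0; have /cvgrPdist_lt /(_ _ (iota_gt0 e0)) := @cvg_id _ (nbhs l).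
by apply: filterS => z; rewrite ltr_nrm// distrC.
Qed.

(** The point [l] is chosen before the family [d], so one cluster point can be tested against
    several families. *)
Lemma compact_cluster_family (T : topologicalType) (A : set T) (x : nat -> T) :
  compact A -> (forall n, A (x n)) ->
  exists l, A l /\ forall d : nat -> T -> K, (forall j, continuous (d j)) ->
    forall J M e, 0 < e -> exists2 k, (M <= k)%N &
      forall j, (j < J)%N -> nrm `|d j (x k) - d j l| < e.
Proof.
move=> cA Ax; have [l [Al xl]] := compact_seq_cluster cA Ax.
exists l; split=> // d dc J M e e0.
suff : nbhs l [set s | forall j, (j < J)%N -> nrm `|d j s - d j l| < e].
  by move=> /xl /(_ M).
elim: J => [|J IH]; first by apply: filterS filterT.
have dJ : nbhs l [set s | nrm `|d J s - d J l| < e].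
  exact: (dc J l) (nbhs_nrm (d J l) e0).
apply: filterS (filterI IH dJ) => s [sJ sJ'] j.
by rewrite ltnS leq_eqVlt => /predU1P[->|/sJ].
Qed.

(** Cluster points stand in for weakly convergent subsequences: only finitely many functionals are
    approximated at a time, and the Eberlein-Smulian theorem is avoided. *)
Lemma wcompact_cluster (S : choiceType) (D : set (S -> K)) (A : set S)
    (x : nat -> S) : wcompact_wrt D A -> (forall n, A (x n)) ->
  exists l, A l /\ forall d : nat -> S -> K, (forall j, D (d j)) ->
    forall J M e, 0 < e -> exists2 k, (M <= k)%N &
      forall j, (j < J)%N -> nrm `|d j (x k) - d j l| < e.
Proof.
move=> cA Ax; have [l [Al xl]] := compact_cluster_family cA Ax.
exists l; split=> // d Dd; apply: xl => j.
pose ev (s : S) : {ptws {f | D f} -> K} := fun f => sval f s.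
move=> s; apply: (@continuous_comp _ _ _ (ev : initial_topology ev -> _)
  (fun h : {ptws {f | D f} -> K} => h (exist D (d j) (Dd j)))).
  exact: initial_continuous.
exact: (@ptws_eval_continuous _ _ (exist D (d j) (Dd j)) (ev s)).
Qed.

(** Rows are points of a product of compact sets, compact by Tychonoff; a cluster point of the rows
    replaces a diagonal extraction. *)
Lemma bounded_rows_cluster (b : nat -> nat -> K) (c : nat -> R) :
  (forall i j, nrm `|b i j| <= c j) ->
  exists a : nat -> K, forall J M e, 0 < e -> exists2 k, (M <= k)%N &
    forall j, (j < J)%N -> nrm `|b k j - a j| < e.
Proof.
move=> bc.
have /choice[A AP] j : exists A : set K, compact A /\
    forall z, nrm `|z| <= c j -> A z.
  by have [A ? ?] := scalar_ball_compact SF (c j); exists A.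
have cA : compact [set f : {ptws nat -> K} | forall j, A j (f j)].
  by apply: tychonoff => j; have [] := AP j.
have [|a [_ aP]] := @compact_cluster_family _ _ (b : nat -> {ptws nat -> K}) cA.
  by move=> i j; have [_] := AP j; apply.
exists a => J M e e0.
by apply: (aP (fun j (h : {ptws nat -> K}) => h j)) => // j;
  exact: ptws_eval_continuous.
Qed.

(** Completeness comes from the compactness of balls: a Cauchy sequence is eventually bounded and
    converges to its cluster point. *)
Lemma scalar_complete (u : nat -> K) :
  (forall e, 0 < e -> exists n, forall m k, (n <= m)%N -> (n <= k)%N ->
    nrm `|u m - u k| <= e) -> exists l : K, u @ \oo --> l.
Proof.
move=> uC; have [n nP] := uC 1 ltr01.
have [A cA AP] := scalar_ball_compact SF (1 + nrm `|u n|).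
have [|l [_ ul]] := @compact_cluster_family _ A (fun m => u (n + m)%N) cA.
  move=> m; apply: AP; rewrite -[u (n + m)%N](subrK (u n)).
  by rewrite (le_trans (ler_nrmD _ _))// lerD2r nP// leq_addr.
exists l; apply/cvg_nrmP => e e0.
have e2 : 0 < e / 2 by lra.
have [n' n'P] := uC _ e2; exists n' => m n'm.
have idc (j : nat) : continuous (id : K -> K) by move=> z; exact: cvg_id.
have [k n'k kl] := ul (fun=> id) idc 1%N n' _ e2.
have := ler_nrm_dist (u m) (u (n + k)%N) l.
have := kl 0%N isT; have := n'P m (n + k)%N n'm (leq_trans n'k (leq_addl _ _)).
lra.
Qed.

Lemma abs_series_cvg (g : nat -> K) B :
  (forall N, \sum_(0 <= j < N) nrm `|g j| <= B) ->
  exists l : K, (fun n => \sum_(0 <= j < n) g j) @ \oo --> l.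
Proof.
move=> gB; apply: scalar_complete => e e0.
have [n nP] := bounded_series_tail (fun j => nrm_norm_ge0 (g j)) gB e0.
suff H m k : (n <= m)%N -> (m <= k)%N ->
    nrm `|\sum_(0 <= j < k) g j - \sum_(0 <= j < m) g j| <= e.
  exists n => m k nm nk; have [mk|km] := leqP m k; last exact: H (ltnW km).
  by rewrite nrm_distC H.
move=> nm mk; rewrite (big_cat_nat (leq0n m) mk)/= addrAC subrr add0r.
by rewrite (le_trans (ler_nrm_sum _ _ _))// nP.
Qed.

Lemma cvg_nrm_dist_le (u : nat -> K) (l z : K) e n :
  u @ \oo --> l -> (forall m, (n <= m)%N -> nrm `|u m - z| <= e) ->
  nrm `|l - z| <= e.
Proof.
move=> /cvg_nrmP ul uz; apply/ler_addgt0Pl => d d0.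
have [m mP] := ul d d0.
have := mP _ (leq_maxr n m); have := uz _ (leq_maxl n m).
have := ler_nrm_dist l (u (maxn n m)) z; rewrite (nrm_distC l (u _)); lra.
Qed.

Lemma cvg_nrm_dist_ge (u : nat -> K) (l z : K) e n :
  u @ \oo --> l -> (forall m, (n <= m)%N -> e <= nrm `|u m - z|) ->
  e <= nrm `|l - z|.
Proof.
move=> /cvg_nrmP ul uz; apply/ler_addgt0Pl => d d0.
have [m mP] := ul d d0.
have := mP _ (leq_maxr n m); have := uz _ (leq_maxl n m).
have := ler_nrm_dist (u (maxn n m)) l z; lra.
Qed.

(** * Linear functionals and the dual norm *)

Section LinearFunctionals.
Context {V : normedModType K}.
Implicit Types (f g : V -> K) (v w : V).

Lemma lin_functional0 f : lin_functional f -> f 0 = 0.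
Proof.
move=> fL; have := fL 1 0 0; rewrite scale1r addr0 mul1r => f0.
by apply: (addrI (f 0)); rewrite addr0 -f0.
Qed.

Lemma lin_functionalD f v w : lin_functional f -> f (v + w) = f v + f w.
Proof. by move=> fL; have := fL 1 v w; rewrite scale1r mul1r. Qed.

Lemma lin_functionalZ f a v : lin_functional f -> f (a *: v) = a * f v.
Proof.
by move=> fL; have := fL a v 0; rewrite addr0 lin_functional0// addr0.
Qed.

Lemma lin_functionalB f v w : lin_functional f -> f (v - w) = f v - f w.
Proof.
by move=> fL; rewrite lin_functionalD// -scaleN1r lin_functionalZ// mulN1r.
Qed.

Lemma lin_functional_sum f (I : Type) (r : seq I) (P : pred I) (F : I -> V) :
  lin_functional f -> f (\sum_(i <- r | P i) F i) = \sum_(i <- r | P i) f (F i).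
Proof.
move=> fL; elim/big_ind2: _ => [|v1 a1 v2 a2 <- <-|//].
  exact: lin_functional0.
exact: lin_functionalD.
Qed.

Lemma dual_ball_dual f : dual_ball nrm f -> is_dual nrm f.
Proof. by move=> [fL fb]; split=> //; exists 1 => v; rewrite mul1r. Qed.

Lemma lin_functional_sub f g : lin_functional f -> lin_functional g ->
  lin_functional (fun v => f v - g v).
Proof. by move=> fL gL a v w; rewrite fL gL; ring. Qed.

Lemma lin_functional_scale a f : lin_functional f ->
  lin_functional (fun v => a * f v).
Proof. by move=> fL b v w; rewrite fL; ring. Qed.

Lemma dual_ball_scale r f : 0 < r -> lin_functional f ->
  (forall v, nrm `|f v| <= r * nrm `|v|) ->
  dual_ball nrm (fun v => iota r^-1 * f v).
Proof.
move=> r0 fL fr; split; first exact: lin_functional_scale.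
by move=> v; rewrite nrm_normM nrm_iota ?invr_ge0 ?(ltW r0)// ler_pdivrMl.
Qed.

Lemma norming_functional v :
  exists f, dual_ball nrm f /\ nrm `|f v| = nrm `|v|.
Proof.
have [||f [fL fb fv]] := @scalar_hahn_banach _ _ _ _ SF V (fun w => nrm `|w|) _ _ v.
- exact: ler_nrmD.
- by move=> a w; rewrite nrm_normZ.
by exists f.
Qed.

Lemma dual_dnorm f : is_dual nrm f ->
  exists r, [/\ 0 <= r, dnorm nrm f = r%:E &
    forall v, nrm `|f v| <= r * nrm `|v|].
Proof.
move=> [fL [c fc]].
have d0 : (0 <= dnorm nrm f)%E.
  apply: ereal_sup_ubound; exists 0; first by rewrite /unit_ball/= nrm_norm0.
  by rewrite lin_functional0// nrm_norm0.
have dc : (dnorm nrm f <= `|c|%:E)%E.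
  apply: ge_ereal_sup => _ [v v1 <-]; rewrite lee_fin (le_trans (fc v))//.
  rewrite (le_trans (ler_wpM2r (nrm_norm_ge0 _) (ler_norm c)))//.
  by rewrite ler_piMr.
have dE : dnorm nrm f = (fine (dnorm nrm f))%:E.
  by rewrite fineK// ge0_fin_numE// (le_lt_trans dc)// ltry.
exists (fine (dnorm nrm f)); split=> //; first by rewrite fine_ge0.
move=> v; have := nrm_norm_ge0 v; rewrite le_eqVlt => /predU1P[v0|v0].
  by rewrite (nrm_norm_eq0 (esym v0)) lin_functional0// !nrm_norm0 mulr0.
rewrite -ler_pdivrMr// -lee_fin -dE; apply: ereal_sup_ubound.
exists (iota (nrm `|v|)^-1 *: v).
  by rewrite /unit_ball/= nrm_normZ nrm_iota ?invr_ge0 ?(ltW v0)// mulVf// gt_eqF.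
rewrite lin_functionalZ// nrm_normM nrm_iota ?invr_ge0 ?(ltW v0)//.
by rewrite mulrC.
Qed.

(** The canonical embedding of a space into its bidual. *)
Lemma bidual_eval v : is_bidual nrm (fun f => f v).
Proof.
split=> //; exists (nrm `|v|) => f /dual_dnorm [r [r0 -> fr]].
by rewrite -EFinM lee_fin mulrC.
Qed.

End LinearFunctionals.

(** * Blocks and subsequences of weakly unconditionally Cauchy series *)

Section WeaklyUnconditionallyCauchy.
Context {X : normedModType K}.
Implicit Types (x : nat -> X) (f : X -> K).

Lemma wuc_ballE x f : wuc_ball nrm x -> dual_ball nrm f ->
  forall N, \sum_(0 <= i < N) nrm `|f (x i)| <= 1.
Proof. by move=> xu fb N; rewrite big_mkord; exact: xu. Qed.

Lemma wuc_ball_dual x f r : wuc_ball nrm x -> 0 <= r -> lin_functional f ->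
  (forall v, nrm `|f v| <= r * nrm `|v|) ->
  forall N, \sum_(0 <= i < N) nrm `|f (x i)| <= r.
Proof.
(* As [r] may be [0], the functional is divided by [e + r] with [e > 0] arbitrary. *)
move=> xu r0 fL fr N; apply/ler_addgt0Pl => e e0.
have er0 : 0 < e + r by lra.
have fer v : nrm `|f v| <= (e + r) * nrm `|v|.
  by rewrite (le_trans (fr v))// ler_wpM2r ?nrm_norm_ge0// lerDr ltW.
have := wuc_ballE xu (dual_ball_scale er0 fL fer) N.
under eq_bigr do rewrite nrm_normM nrm_iota ?invr_ge0 ?(ltW er0)//.
by rewrite -mulr_sumr ler_pdivrMl// mulr1.
Qed.

(** The blocks are disjoint and in order, so by the triangle inequality the first [N] of them cost
    no more than the first [p N] terms. *)
Lemma wuc_ball_blocks x (p q : nat -> nat) : wuc_ball nrm x ->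
  (forall k, (p k <= q k <= p k.+1)%N) ->
  wuc_ball nrm (fun k => \sum_(p k <= i < q k) x i).
Proof.
move=> xu pq f fb N.
rewrite -(big_mkord predT (fun k => nrm `|f (\sum_(p k <= i < q k) x i)|)).
apply: le_trans (wuc_ballE xu fb (p N)).
elim: N => [|N IH]; first by rewrite big_geq// sumr_ge0// => i _; exact: nrm_norm_ge0.
have /andP[pqN qpN] := pq N.
rewrite big_nat_recr//= (big_cat_nat (leq0n (p N)) (leq_trans pqN qpN))/=.
rewrite lerD// lin_functional_sum; last exact: fb.1.
apply: le_trans (ler_nrm_sum _ _ _) _.
rewrite [leRHS](big_cat_nat pqN qpN)/= lerDl sumr_ge0// => i _.
exact: nrm_norm_ge0.
Qed.

Lemma wuc_ball_subseq x phi : wuc_ball nrm x ->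
  (forall p, phi p < phi p.+1)%N -> wuc_ball nrm (x \o phi).
Proof.
move=> xu phiS.
have -> : x \o phi = fun k => \sum_(phi k <= i < (phi k).+1) x i.
  by apply/funext => k; rewrite big_nat1.
by apply: wuc_ball_blocks => // k; rewrite leqnSn phiS.
Qed.

Lemma wuc_ball_sum_unit_ball x n : wuc_ball nrm x ->
  unit_ball nrm (\sum_(0 <= i < n) x i).
Proof.
move=> xu; have [f [fb fE]] := norming_functional (\sum_(0 <= i < n) x i).
rewrite /unit_ball/= -fE lin_functional_sum; last exact: fb.1.
exact: le_trans (ler_nrm_sum _ _ _) (wuc_ballE xu fb n).
Qed.

End WeaklyUnconditionallyCauchy.

Lemma block_choice (P : nat -> nat -> Prop) :
  (forall N, exists n m, [/\ (N <= n)%N, (n <= m)%N & P n m]) ->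
  exists p q : nat -> nat,
    (forall k, (p k <= q k <= p k.+1)%N) /\ forall k, P (p k) (q k).
Proof.
move=> /choice[n /choice[m nmP]].
(* Each pair is sought beyond the end [m (z k)] of the preceding block. *)
pose z := fix z k := if k is k'.+1 then m (z k') else 0%N.
exists (n \o z), (m \o z); split=> k /=; last by case: (nmP (z k)).
by have [_ -> _] := nmP (z k); have [-> _ _] := nmP (m (z k)).
Qed.

Lemma hump_sum_ge (b : nat -> K) k n (e d : R) : (k < n)%N ->
  d <= nrm `|b k| -> \sum_(0 <= l < n | l != k) nrm `|b l| <= e ->
  d - e <= nrm `|\sum_(0 <= l < n) b l|.
Proof.
move=> kn dk be; rewrite (bigD1_seq k) ?mem_index_iota ?iota_uniq//=.
have := le_trans (ler_nrm_sum (index_iota 0 n) (fun l => l != k) b) be.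
have := ler_nrmB (b k + \sum_(0 <= l < n | l != k) b l)
  (\sum_(0 <= l < n | l != k) b l).
rewrite addrK; lra.
Qed.

(** * Weakly unconditionally Cauchy series and the Right topology *)

Section RhoCauchy.
Context {X : normedModType K}.
Implicit Types (x u : nat -> X) (f g h : X -> K) (L : set (X -> K)).

Lemma wuc_ball_dual_bounded u f : wuc_ball nrm u -> is_dual nrm f ->
  exists B, forall N, \sum_(0 <= j < N) nrm `|f (u j)| <= B.
Proof.
move=> uu fd; have [r [r0 _ fr]] := dual_dnorm fd.
by exists r; exact: wuc_ball_dual uu r0 fd.1 fr.
Qed.

(** [Phi] is the weak-star limit of the partial sums in the bidual. *)
Lemma wuc_ball_bidual u : wuc_ball nrm u ->
  exists Phi : (X -> K) -> K, is_bidual nrm Phi /\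
    forall f, is_dual nrm f ->
      (fun n => \sum_(0 <= j < n) f (u j)) @ \oo --> Phi f.
Proof.
move=> uu.
have /choice[Phi PhiP] (f : X -> K) : exists l : K, is_dual nrm f ->
    (fun n => \sum_(0 <= j < n) f (u j)) @ \oo --> l.
  (* The value [0] off the dual is a mere default. *)
  have [fd|] := pselect (is_dual nrm f); last by exists 0.
  have [B fB] := wuc_ball_dual_bounded uu fd.
  by have [l ?] := abs_series_cvg fB; exists l.
exists Phi; split=> //; split.
  move=> a f g fd gd.
  have hd : is_dual nrm (fun v => a * f v + g v).
    split=> [b v w|]; first by rewrite fd.1 gd.1; ring.
    have [r [_ _ fr]] := dual_dnorm fd; have [s [_ _ gs]] := dual_dnorm gd.
    exists (nrm `|a| * r + s) => v; rewrite (le_trans (ler_nrmD _ _))//.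
    by rewrite mulrDl lerD// nrm_normM -mulrA ler_wpM2l ?nrm_norm_ge0.
  have h1 := PhiP _ hd.
  have h2 : (fun n => \sum_(0 <= j < n) (a * f (u j) + g (u j))) @ \oo -->
      a * Phi f + Phi g.
    rewrite (_ : (fun n => _) = (fun n =>
        a * \sum_(0 <= j < n) f (u j) + \sum_(0 <= j < n) g (u j))); last first.
      by apply/funext => n; rewrite big_split/= mulr_sumr.
    by apply: cvgD; [apply: cvgM; [exact: cvg_cst | exact: PhiP] | exact: PhiP].
  exact: (cvg_unique _ h1 h2).
exists 1 => f fd; have [r [r0 -> fr]] := dual_dnorm fd.
rewrite mul1e lee_fin -[Phi f]subr0.
apply: (cvg_nrm_dist_le (n := 0) (PhiP f fd)) => m _; rewrite subr0.
by rewrite (le_trans (ler_nrm_sum _ _ _))// (wuc_ball_dual uu r0 fd.1 fr).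
Qed.

(* Let [f] be a weak cluster point of [g] in [L].  If the diagonal stayed large,
   a gliding hump along [g k - f] would yield a sum [Phi] of a subseries of [u]
   with [Phi (g k - f)] bounded away from [0]; but any weak cluster point of
   the corresponding subsequence of [g] agrees with [f] at all [u j], hence at
   [Phi]. *)
Lemma wcompact_dual_wuc_diag L u (g : nat -> X -> K) (e : R) :
  wcompact_dual nrm L -> wuc_ball nrm u -> (forall k, L (g k)) -> 0 < e ->
  exists k, nrm `|g k (u k)| <= e.
Proof.
move=> [Ldual Lc] uu gL e0; apply: contrapT => no.
have ge_e k : e < nrm `|g k (u k)|.
  by rewrite ltNge; apply/negP => ke; apply: no; exists k.
have [f [Lf gf]] := wcompact_cluster Lc gL.
have rows k : exists B, forall N,
    \sum_(0 <= j < N) nrm `|g k (u j) - f (u j)| <= B.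
  have [B gB] := wuc_ball_dual_bounded uu (Ldual _ (gL k)).
  have [B' fB'] := wuc_ball_dual_bounded uu (Ldual _ Lf).
  exists (B + B') => N; rewrite (le_trans _ (lerD (gB N) (fB' N)))//.
  by rewrite -big_split/=; apply: ler_sum => j _; exact: ler_nrmB.
have [B fB] := wuc_ball_dual_bounded uu (Ldual _ Lf).
have e2 : 0 < e / 2 by lra.
have e4 : 0 < e / 4 by lra.
(* From [N0] on [f (u j)] is at most [e / 2], which leaves at least [e / 2] on the diagonal of
   [g k - f]. *)
have [N0 N0P] := bounded_series_term (fun j => nrm_norm_ge0 (f (u j))) fB e2.
have evu j : is_bidual nrm (fun h : X -> K => h (u j)) by exact: bidual_eval.
have cols J N d : 0 < d -> exists2 k, (N <= k)%N &
    forall j, (j < J)%N -> nrm `|g k (u j) - f (u j)| < d.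
  exact: (gf (fun j h => h (u j)) evu J N d).
have [phi [N0phi phiS hump lim0]] := gliding_hump N0
  (fun i j => nrm_norm_ge0 (g i (u j) - f (u j))) rows cols e4.
have [Phi [Phib PhiP]] := wuc_ball_bidual (wuc_ball_subseq uu phiS).
have [f' [Lf' gf']] := wcompact_cluster Lc (fun k => gL (phi k)).
have ff' j : f' (u j) = f (u j).
  apply: subr0_eq; apply: nrm_norm_eq0; apply/eqP.
  rewrite eq_le nrm_norm_ge0 andbT; apply/ler_addgt0Pl => d d0.
  have d2 : 0 < d / 2 by lra.
  have [M MP] := lim0 j _ d2.
  have [k Mk /(_ j (ltnSn j))] := gf' (fun j h => h (u j)) evu j.+1 M _ d2.
  have := MP k Mk; have := ler_nrm_dist (f' (u j)) (g (phi k) (u j)) (f (u j)).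
  rewrite (nrm_distC (f' (u j)) (g _ _)); lra.
have Phiff' : Phi f' = Phi f.
  have sE : (fun n => \sum_(0 <= j < n) f' ((u \o phi) j)) =
      (fun n => \sum_(0 <= j < n) f ((u \o phi) j)).
    by apply/funext => n; apply: eq_bigr => j _; exact: ff'.
  have Phif' := PhiP _ (Ldual _ Lf'); rewrite sE in Phif'.
  exact: (cvg_unique _ Phif' (PhiP _ (Ldual _ Lf))).
(* The cluster point yields a [k] with [Phi (g (phi k)) - Phi f] below [e / 4], whereas the hump
   bounds it below by [e / 2] from the diagonal less [e / 4] from the rest. *)
have [k _ /(_ 0%N isT)] := gf' (fun=> Phi) (fun=> Phib) 1%N 0%N _ e4.
rewrite Phiff' ltNge => /negP; apply; rewrite -[Phi _ - _]subr0.
have sub_cvg : (fun n => \sum_(0 <= j < n) g (phi k) (u (phi j)) -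
    \sum_(0 <= j < n) f (u (phi j))) @ \oo --> Phi (g (phi k)) - Phi f.
  by apply: cvgB; [exact: PhiP (Ldual _ (gL _)) | exact: PhiP (Ldual _ Lf)].
apply: (@cvg_nrm_dist_ge _ _ 0 (e / 4) k.+1 sub_cvg) => m km; rewrite subr0.
rewrite -sumrB.
have -> : e / 4 = e / 2 - e / 4 by lra.
apply: hump_sum_ge km _ (hump k m).
have := ge_e (phi k); have := N0P _ (N0phi k).
have := ler_nrm_dist (g (phi k) (u (phi k))) (f (u (phi k))) 0.
rewrite !subr0; lra.
Qed.

(** If uniform convergence on [L] failed, there would be successive blocks and functionals of [L]
    exceeding [e] on them; the blocks form again a series in [wuc_ball], against
    [wcompact_dual_wuc_diag]. *)
Lemma wuc_ball_rho_cauchy x : wuc_ball nrm x ->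
  rho_cauchy nrm (fun n => \sum_(0 <= i < n) x i).
Proof.
move=> xu L Lc e e0; apply: contrapT => no.
have split_sum n m : (n <= m)%N ->
    \sum_(0 <= i < m) x i - \sum_(0 <= i < n) x i = \sum_(n <= i < m) x i.
  by move=> nm; rewrite (big_cat_nat (leq0n n) nm)/= addrAC subrr add0r.
pose P n m := exists f, L f /\ e < nrm `|f (\sum_(n <= i < m) x i)|.
have [|p [q [pq pqP]]] := @block_choice P.
  move=> N; apply: contrapT => noN; apply: no; exists N => n m Nn Nm f Lf.
  rewrite leNgt; apply/negP => fnm; apply: noN.
  have fL : lin_functional f by have [] := Lc.1 f Lf.
  have [nm|mn] := leqP n m.
    exists n, m; split=> //; exists f; split=> //.
    by rewrite -split_sum// lin_functionalB// nrm_distC.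
  exists m, n; split=> //; first exact: ltnW.
  by exists f; split=> //; rewrite -split_sum ?(ltnW mn)// lin_functionalB.
have [g gP] := choice pqP.
have gL k : L (g k) := (gP k).1.
have [k] := wcompact_dual_wuc_diag Lc (wuc_ball_blocks xu pq) gL e0.
by rewrite leNgt (gP k).2.
Qed.

End RhoCauchy.

(** * Comparison of the quantities *)

Section Comparison.
Context {Y : normedModType K}.
Implicit Types (y : nat -> Y).

Lemma lee_real_gt (a b : \bar R) :
  (forall r : R, (b < r%:E)%E -> (a <= r%:E)%E) -> (a <= b)%E.
Proof.
move=> ab; rewrite leNgt; apply/negP; case: b ab => [b| |] ab.
- case: a ab => [a| |] ab //; last first.
    by move=> _; have /(_ _) := ab (b + 1); rewrite lte_fin ltrDl ltr01 => /(_ isT).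
  rewrite lte_fin => ba; have := ab ((a + b) / 2).
  rewrite lte_fin lee_fin; lra.
- by rewrite ltNge leey.
- case: a ab => [a| |] ab //.
    by move=> _; have := ab (a - 1) (ltNyr _); rewrite lee_fin; lra.
  by have := ab 0 (ltNyr _).
Qed.

Lemma wstar_dist_le_omega y : (wstar_dist nrm y <= omega nrm (range y))%E.
Proof.
apply: le_ereal_inf_tmp => _ [C [C0 wC] <-]; apply: lee_real_gt => r yr.
have /choice[k kP] n : exists c, C c /\ nrm `|y n - c| < r.
  have : (ereal_inf [set (nrm `|y n - c|)%:E | c in C] < r%:E)%E.
    by apply: le_lt_trans yr; apply: ereal_sup_ubound; exists (y n) => //; exists n.
  by move=> /ereal_inf_lt[_ [c Cc <-]]; rewrite lte_fin => ?; exists c.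
(* The cluster point [c] of the approximants is the candidate for a nearest point of [Y]: a
   functional of the dual ball moves by less than [r] from [y n] to [k n]. *)
have [c [Cc kc]] := wcompact_cluster wC (fun n => (kP n).1).
apply: (@le_trans _ _ (ereal_sup [set e | exists (ys : Y -> K) (l : K),
  [/\ dual_ball nrm ys, (fun n => ys (y n)) @ \oo --> l
    & e = (nrm `|l - ys c|)%:E]])).
  by apply: ereal_inf_lbound; exists c.
apply: ge_ereal_sup => _ [ys [l [ysb /cvg_nrmP yl ->]]].
rewrite lee_fin; apply/ler_addgt0Pl => d d0; have d2 : 0 < d / 2 by lra.
have [n nP] := yl _ d2.
have [m nm /(_ 0%N isT)] := kc (fun=> ys) (fun=> dual_ball_dual ysb) 1%N n _ d2.
have := nP m nm; rewrite nrm_distC.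
have : nrm `|ys (y m) - ys (k m)| < r.
  rewrite -lin_functionalB; last exact: ysb.1.
  exact: le_lt_trans (ysb.2 _) (kP m).2.
have := ler_nrm_dist l (ys (y m)) (ys c).
have := ler_nrm_dist (ys (y m)) (ys (k m)) (ys c).
lra.
Qed.

Lemma finite_wcompact (C : set Y) : finite_set C -> wcompact nrm C.
Proof. by move=> fC; exact: finite_compact. Qed.

Lemma omega_le_ca y : (omega nrm (range y) <= ca nrm y)%E.
Proof.
apply: le_ereal_inf_tmp => _ [n _ <-].
set S := ereal_sup _.
have le_S k l : (n <= k)%N -> (n <= l)%N -> ((nrm `|y k - y l|)%:E <= S)%E.
  by move=> nk nl; apply: ereal_sup_ubound; exists (k, l).
apply: (@le_trans _ _ (ereal_sup [set ereal_inf [set (nrm `|a - c|)%:E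
    | c in y @` `I_n.+1] | a in range y])).
  apply: ereal_inf_lbound; exists (y @` `I_n.+1) => //; split.
    by exists (y 0%N), 0%N.
  by apply: finite_wcompact; apply: finite_image; exact: finite_II.
apply: ge_ereal_sup => _ [_ [m _ <-] <-].
have [mn|nm] := ltnP m n.+1.
  apply: (@le_trans _ _ (nrm `|y m - y m|)%:E).
    by apply: ereal_inf_lbound; exists (y m) => //; exists m.
  by rewrite subrr -(subrr (y n)); exact: le_S.
apply: (@le_trans _ _ (nrm `|y m - y n|)%:E).
  by apply: ereal_inf_lbound; exists (y n) => //; exists n => /=.
by apply: le_S => //; exact: ltnW.
Qed.

Lemma rho_cauchy_wcauchy y : rho_cauchy nrm y -> wcauchy nrm y.
Proof.
move=> yr f fd; apply: cauchy_exP => e e0.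
have e20 : 0 < nrm e / 2 by rewrite divr_gt0// nrm_gt0.
(* A single functional is a weakly compact set; the half turns the weak inequality into a strict
   one. *)
have [|N NP] := yr [set f] _ (nrm e / 2) e20.
  by split; [move=> _ -> | apply: finite_compact; exact: finite_set1].
exists (f (y N)), N => // m /= Nm; rewrite -ball_normE /=.
rewrite -[e](scalar_nrmK SF (ltW e0)) ltr_nrm//.
have := NP N m (leqnn N) Nm f erefl.
have := nrm_gt0 e0; lra.
Qed.

End Comparison.

(** * Separation from a subspace and the bound of [uc] by [Rcc] *)

Section QuotientFunctional.
Context {Y : normedModType K}.

(* Hahn-Banach applied to the distance to [Z]. *)
Lemma dist_functional (Z : set Y) (y0 : Y) : Z 0 ->
  (forall y z, Z y -> Z z -> Z (y + z)) ->
  (forall a z, Z z -> Z (a *: z)) ->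
  exists f, [/\ dual_ball nrm f, forall z, Z z -> f z = 0 &
    forall e, 0 < e -> exists2 z, Z z & nrm `|y0 - z| < nrm `|f y0| + e].
Proof.
move=> Z0 ZD ZZ; pose D y := [set nrm `|y - z| | z in Z].
have D0 y : D y !=set0 by exists (nrm `|y - 0|), 0.
have lD y : has_lbound (D y).
  by exists 0 => _ [z _ <-]; exact: nrm_norm_ge0.
have D_le y z : Z z -> inf (D y) <= nrm `|y - z|.
  by move=> Zz; apply: ge_inf => //; exists z.
have D_ge0 y : 0 <= inf (D y).
  by apply: lb_le_inf => // _ [z _ <-]; exact: nrm_norm_ge0.
have [||f [fL fD fy0]] := @scalar_hahn_banach _ _ _ _ SF Y (fun y => inf (D y)) _ _ y0.
- move=> x y; apply: inf_leD => // _ _ [z Zz <-] [z' Zz' <-].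
  exists (nrm `|x + y - (z + z')|); first by exists (z + z') => //; exact: ZD.
  by rewrite opprD addrACA ler_nrmD.
- move=> a x; have := nrm_norm_ge0 a; rewrite le_eqVlt => /predU1P[a0|a0].
    rewrite -a0 (nrm_norm_eq0 (esym a0)) scale0r mul0r.
    by apply: le_trans (D_le 0 0 Z0) _; rewrite subrr nrm_norm0.
  apply: inf_leM => // _ [z Zz <-].
  exists (nrm `|a *: x - a *: z|); first by exists (a *: z) => //; exact: ZZ.
  by rewrite -scalerBr nrm_normZ.
exists f; split.
- split=> // y; apply: le_trans (fD y) _.
  by rewrite -[X in _ <= nrm `|X|]subr0; exact: D_le.
- move=> z Zz; apply: nrm_norm_eq0; apply/eqP.
  rewrite eq_le nrm_norm_ge0 andbT (le_trans (fD z))//.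
  by apply: le_trans (D_le z z Zz) _; rewrite subrr nrm_norm0.
- move=> e e0; have [_ [z Zz <-]] := inf_adherent e0 (conj (D0 y0) (lD y0)).
  by rewrite -fy0; exists z.
Qed.

End QuotientFunctional.

(** Carries a hump estimate over all blocks to the blocks of even index. *)
Lemma ler_sum_double (g : nat -> R) k m : (forall j, 0 <= g j) ->
  \sum_(0 <= l < m | l.*2 != k) g l.*2 <= \sum_(0 <= j < m.*2 | j != k) g j.
Proof.
move=> g0; rewrite big_mkcond [leRHS]big_mkcond/=.
pose g' j := if j != k then g j else 0.
apply: (@ler_sum_subseq _ g' double 0 m m.*2).
- by move=> j; rewrite /g'; case: ifP.
- by move=> p; rewrite ltn_double.
- by move=> l; rewrite ltn_double.
Qed.

Lemma block_of_ca (Y : normedModType K) (y : nat -> Y) (c : R) :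
  (c%:E < ca nrm (fun n => \sum_(i < n.+1) y i)%R)%E ->
  forall N, exists n m, [/\ (N <= n)%N, (n <= m)%N &
    c < nrm `|\sum_(n <= i < m) y i|].
Proof.
move=> c_ca N.
have : (c%:E < ereal_sup
    [set (nrm `|\sum_(i < kl.1.+1) y i - \sum_(i < kl.2.+1) y i|)%R%:E
    | kl in [set kl : nat * nat | (N <= kl.1)%N /\ (N <= kl.2)%N]])%E.
  by apply: lt_le_trans c_ca _; apply: ereal_inf_lbound; exists N.
move=> /ereal_sup_gt[_ [[k l] /= [Nk Nl] <-]]; rewrite lte_fin.
have split_sum n m : (n <= m)%N ->
    \sum_(i < m) y i - \sum_(i < n) y i = \sum_(n <= i < m) y i.
  move=> nm; rewrite -!(big_mkord predT) (big_cat_nat (leq0n n) nm)/=.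
  by rewrite addrAC subrr add0r.
have [kl|lk] := leqP k l.
  (* The sum of index [k] includes the term [k], so the block starts at [k.+1]. *)
  rewrite nrm_distC split_sum// => ckl; exists k.+1, l.+1; split=> //.
  exact: leqW.
rewrite split_sum ?ltnS ?(ltnW lk)// => clk; exists l.+1, k.+1.
by split=> //; [exact: leqW | exact: ltnW].
Qed.

Section UcRcc.
Context {X Y : normedModType K} (T : {linear X -> Y}).

Lemma continuous_linear_nrm_bounded : continuous T ->
  exists2 r, 0 < r & forall v, nrm `|T v| <= r * nrm `|v|.
Proof.
move=> /linear_bounded_continuous/linear_boundedP/pinfty_ex_gt0[r r0 Tr].
exists (nrm r); first exact: nrm_gt0.
by move=> v; rewrite -(nrmM (ltW r0) (normr_ge0 v)) ler_nrm.
Qed.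

(* The functionals [w k] norm the blocks [T (u k)] of the series.  After a
   gliding hump, [w p - w q] is large on the partial sums of the even blocks
   when [p] is even and [q] is odd.  On the other hand it tends to [0] on the
   subspace [Z] of the points where [w] converges, which contains all blocks:
   so no point of [Y] close to [Z] can be close to the limit of the partial
   sums, and a point far from [Z] is separated from [Z] by a functional. *)
Lemma uc_block_rho_cauchy (x : nat -> X) (c : R) : continuous T ->
  wuc_ball nrm x -> 0 < c ->
  (c%:E < ca nrm (fun n => \sum_(i < n.+1) T (x i))%R)%E ->
  exists t, [/\ ball_seq nrm t, rho_cauchy nrm t &
    ((c / 16)%:E <= wstar_dist nrm (T \o t))%E].
Proof.
move=> /continuous_linear_nrm_bounded[r r0 Tr] xu c0 c_ca.
have [p [q [pq cu]]] := block_choice (block_of_ca (y := T \o x) c_ca).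
pose u k := \sum_(p k <= i < q k) x i.
have uu : wuc_ball nrm u by exact: wuc_ball_blocks.
have {}cu k : c < nrm `|T (u k)| by rewrite linear_sum; exact: cu.
have [w wP] := choice (fun k => norming_functional (T (u k))).
have wb k : dual_ball nrm (w k) := (wP k).1.
have wE k : nrm `|w k (T (u k))| = nrm `|T (u k)| := (wP k).2.
have comp_lin (f : Y -> K) : lin_functional f -> lin_functional (f \o T).
  by move=> fL a v v'; rewrite /= linearP fL.
have rowsT i N : \sum_(0 <= j < N) nrm `|w i (T (u j))| <= r.
  apply: (wuc_ball_dual uu (ltW r0) (comp_lin _ (wb i).1)) => v /=.
  exact: le_trans ((wb i).2 _) (Tr v).
(* [a j] is the prospective limit of column [j]; the bound [r] on row sums passes to [a] by
   comparison with one row close to it on the first [N] columns. *)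
have [a aP] := bounded_rows_cluster (fun i j => (wb i).2 (T (u j))).
have a_sum N : \sum_(0 <= j < N) nrm `|a j| <= r.
  apply/ler_addgt0Pl => e e0.
  have eN : 0 < e / N.+1%:R by rewrite divr_gt0.
  set d := e / N.+1%:R in eN *.
  have [k _ kP] := aP N 0%N _ eN.
  apply: (@le_trans _ _ (\sum_(0 <= j < N) (d + nrm `|w k (T (u j))|))).
    rewrite big_nat [leRHS]big_nat; apply: ler_sum => j /andP[_ jN].
    have := kP j jN; have := ler_nrm_dist (a j) (w k (T (u j))) 0.
    rewrite !subr0 (nrm_distC (a j)); lra.
  rewrite big_split/= lerD ?rowsT// sumr_const_nat subn0 -mulr_natr.
  by rewrite /d -[leLHS]mulrA ler_piMr ?(ltW e0)// ler_pdivrMl// mulr1 ler_nat.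
have rows i : exists B, forall N,
    \sum_(0 <= j < N) nrm `|w i (T (u j)) - a j| <= B.
  exists (r + r) => N; rewrite (le_trans _ (lerD (rowsT i N) (a_sum N)))//.
  by rewrite -big_split/=; apply: ler_sum => j _; exact: ler_nrmB.
have c2 : 0 < c / 2 by lra.
have c16 : 0 < c / 16 by lra.
(* Beyond [N0] subtracting [a] costs at most [c / 2] of the diagonal, which exceeds [c]. *)
have [N0 N0P] := bounded_series_term (fun j => nrm_norm_ge0 (a j)) a_sum c2.
have [phi [N0phi phiS hump lim0]] := gliding_hump N0
  (fun i j => nrm_norm_ge0 (w i (T (u j)) - a j)) rows
  (fun J N => aP J N) c16.
have diag k : c / 2 <= nrm `|w (phi k) (T (u (phi k))) - a (phi k)|.
  have := cu (phi k); have := N0P _ (N0phi k); rewrite -wE.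
  have := ler_nrm_dist (w (phi k) (T (u (phi k)))) (a (phi k)) 0.
  rewrite !subr0; lra.
have dS k : (phi k.*2 < phi k.+1.*2)%N by apply: ltn_iter_ltn; rewrite ?ltn_double.
have u2u : wuc_ball nrm (fun l => u (phi l.*2)) by exact: (wuc_ball_subseq uu dS).
exists (fun n => \sum_(0 <= l < n) u (phi l.*2)); split.
- by move=> n; exact: wuc_ball_sum_unit_ball.
- exact: wuc_ball_rho_cauchy.
apply: le_ereal_inf_tmp => _ [y0 _ <-].
have fT (f : Y -> K) n : lin_functional f ->
    f (T (\sum_(0 <= l < n) u (phi l.*2))) = \sum_(0 <= l < n) f (T (u (phi l.*2))).
  by move=> fL; rewrite linear_sum lin_functional_sum.
pose Z := [set y | forall e, 0 < e -> exists M, forall i j, (M <= i)%N ->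
  (M <= j)%N -> nrm `|w (phi i) y - w (phi j) y| < e].
have uZ j : Z (T (u j)).
  move=> e e0; have e2 : 0 < e / 2 by lra.
  have [M MP] := lim0 j _ e2; exists M => i i' Mi Mi'.
  have := MP i Mi; have := MP i' Mi'.
  have := ler_nrm_dist (w (phi i) (T (u j))) (a j) (w (phi i') (T (u j))).
  rewrite (nrm_distC (a j)); lra.
have [|||f [fb fZ fy0]] := @dist_functional Y Z y0.
- move=> e e0; exists 0%N => i j _ _.
  rewrite (lin_functional0 (wb (phi i)).1) (lin_functional0 (wb (phi j)).1).
  by rewrite subrr nrm_norm0.
- move=> y z Zy Zz e e0; have e2 : 0 < e / 2 by lra.
  have [M MP] := Zy _ e2; have [M' MP'] := Zz _ e2.
  exists (maxn M M') => i j; rewrite !geq_max => /andP[Mi M'i] /andP[Mj M'j].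
  rewrite (lin_functionalD _ _ (wb (phi i)).1) (lin_functionalD _ _ (wb (phi j)).1).
  rewrite opprD addrACA (le_lt_trans (ler_nrmD _ _))//.
  have := MP i j Mi Mj; have := MP' i j M'i M'j; lra.
- move=> b z Zz e e0.
  have b0 : 0 < nrm `|b| + 1 by rewrite ltr_wpDl ?nrm_norm_ge0.
  have [M MP] := Zz _ (divr_gt0 e0 b0); exists M => i j Mi Mj.
  rewrite (lin_functionalZ _ _ (wb (phi i)).1) (lin_functionalZ _ _ (wb (phi j)).1).
  rewrite -mulrBr nrm_normM; have := MP i j Mi Mj; rewrite ltr_pdivlMr// => h.
  apply: le_lt_trans h; rewrite mulrC ler_wpM2l ?nrm_norm_ge0//; lra.
(* If [f y0] is large, [f] itself is the witness, since it vanishes on the images of all the partial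
   sums. *)
have [fbig|fsmall] := leP (c / 16) (nrm `|f y0|).
  apply: (@le_trans _ _ (nrm `|0 - f y0|)%:E).
    by rewrite lee_fin sub0r nrm_normN.
  apply: ereal_sup_ubound; exists f, 0; split=> //.
  rewrite [X in X @ _ --> _](_ : _ = fun=> 0); first exact: cvg_cst.
  apply/funext => n /=; rewrite fT ?big1//; last exact: fb.1.
  by move=> l _; rewrite fZ.
(* Now [z] is within [c / 16 + c / 32] of [y0]; as [D] has norm at most [2] and is below [c / 16] at
   [z], it is at most [c / 4] at [y0]. *)
have c32 : 0 < c / 32 by lra.
have [z Zz y0z] := fy0 _ c32.
have [M MP] := Zz _ c16.
pose D v := w (phi M.*2) v - w (phi M.*2.+1) v.
have DL : lin_functional D by exact: lin_functional_sub (wb _).1 (wb _).1.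
have D2 v : nrm `|D v| <= 2 * nrm `|v|.
  have := ler_nrmB (w (phi M.*2) v) (w (phi M.*2.+1) v).
  have := (wb (phi M.*2)).2 v; have := (wb (phi M.*2.+1)).2 v; rewrite -/(D v); lra.
have M2 : (M <= M.*2)%N by rewrite -addnn leq_addl.
have Dy0 : nrm `|D y0| <= c / 4.
  have : nrm `|D z| < c / 16 by apply: MP => //; exact: leqW.
  have := D2 (y0 - z); rewrite lin_functionalB//.
  have := ler_nrm_dist (D y0) (D z) 0; rewrite !subr0; lra.
(* The even row meets its diagonal entry among the even blocks, the odd row does not, and [a]
   cancels: [c / 2] less twice [c / 16] remains. *)
have Dt n : (M < n)%N -> 3 * c / 8 <=
    nrm `|D (T (\sum_(0 <= l < n) u (phi l.*2)))|.
  move=> Mn; rewrite fT//.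
  have -> : \sum_(0 <= l < n) D (T (u (phi l.*2))) =
      \sum_(0 <= l < n) (w (phi M.*2) (T (u (phi l.*2))) - a (phi l.*2)) -
      \sum_(0 <= l < n) (w (phi M.*2.+1) (T (u (phi l.*2))) - a (phi l.*2)).
    by rewrite -sumrB; apply: eq_bigr => l _; rewrite /D; ring.
  have le1 : c / 2 - c / 16 <=
      nrm `|\sum_(0 <= l < n) (w (phi M.*2) (T (u (phi l.*2))) - a (phi l.*2))|.
    apply: (hump_sum_ge Mn); first exact: diag.
    apply: le_trans (hump M.*2 n.*2).
    apply: le_trans (ler_sum_double M.*2 n (fun j => nrm_norm_ge0
      (w (phi M.*2) (T (u (phi j))) - a (phi j)))).
    rewrite le_eqVlt; apply/orP; left; apply/eqP; apply: eq_bigl => l.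
    by rewrite -!mul2n eqn_pmul2l.
  have le2 : nrm `|\sum_(0 <= l < n)
      (w (phi M.*2.+1) (T (u (phi l.*2))) - a (phi l.*2))| <= c / 16.
    apply: le_trans (ler_nrm_sum _ _ _) _.
    apply: le_trans (hump M.*2.+1 n.*2).
    apply: le_trans (ler_sum_double M.*2.+1 n (fun j => nrm_norm_ge0
      (w (phi M.*2.+1) (T (u (phi j))) - a (phi j)))).
    rewrite le_eqVlt; apply/orP; left; apply/eqP; apply: eq_bigl => l.
    by apply/esym/eqP => /(congr1 odd); rewrite /= !odd_double.
  set A := \sum_(0 <= l < n) _ in le1 *; set B := \sum_(0 <= l < n) _ in le2 *.
  have := ler_nrm_dist A B 0; rewrite !subr0; lra.
(* Halving puts [D] into the dual ball, and the gap becomes half of [3 * c / 8 - c / 4], that is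
   [c / 16]. *)
pose ys v := iota 2^-1 * D v.
have ysb : dual_ball nrm ys by exact: dual_ball_scale.
have ysT : is_dual nrm (ys \o T).
  split; first exact: comp_lin ysb.1.
  by exists r => v; exact: le_trans (ysb.2 _) (Tr v).
have [B yB] := wuc_ball_dual_bounded u2u ysT.
have [l yl] := abs_series_cvg yB.
apply: (@le_trans _ _ (nrm `|l - ys y0|)%:E); last first.
  apply: ereal_sup_ubound; exists ys, l; split=> //.
  rewrite [X in X @ _ --> _](_ : _ = fun n =>
    \sum_(0 <= j < n) (ys \o T) (u (phi j.*2)))//.
  by apply/funext => n /=; rewrite fT//; exact: ysb.1.
rewrite lee_fin; apply: (@cvg_nrm_dist_ge _ _ (ys y0) _ M.+1 yl) => n Mn.
have -> : \sum_(0 <= j < n) (ys \o T) (u (phi j.*2)) =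
    ys (T (\sum_(0 <= l < n) u (phi l.*2))) by rewrite fT//; exact: ysb.1.
rewrite /ys -mulrBr nrm_normM nrm_iota; last by lra.
have := Dt n Mn.
have := ler_nrm_dist (D (T (\sum_(0 <= l < n) u (phi l.*2)))) (D y0) 0.
rewrite !subr0; lra.
Qed.

Lemma wstar_dist_ge0 (y : nat -> Y) : (0 <= wstar_dist nrm y)%E.
Proof.
apply: le_ereal_inf_tmp => _ [y0 _ <-]; apply: ereal_sup_ubound.
exists (fun=> 0), 0; split; [|exact: cvg_cst|by rewrite subr0 nrm_norm0].
by split=> [a v w|v]; [rewrite mulr0 addr0 | rewrite nrm_norm0 nrm_norm_ge0].
Qed.

Lemma Rcc_ge0 : (0 <= Rcc nrm T)%E.
Proof.
apply: le_trans (wstar_dist_ge0 (T \o (fun=> 0))) _; apply: ereal_sup_ubound.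
exists (fun=> 0) => //; split=> [n|L _ e e0]; first by rewrite /unit_ball/= nrm_norm0.
by exists 0%N => n m _ _ f _; rewrite subrr nrm_norm0 ltW.
Qed.

Lemma uc_le_Rcc : continuous T -> (uc nrm T <= 16%:E * Rcc nrm T)%E.
Proof.
move=> Tc; apply: ge_ereal_sup => _ [x xu <-]; apply: lee_real_gt => c Rc.
have c0 : 0 < c.
  rewrite -lte_fin (le_lt_trans _ Rc)// mule_ge0 ?lee_fin ?Rcc_ge0//.
rewrite leNgt; apply/negP => cx.
have [t [tb tr tc]] := uc_block_rho_cauchy Tc xu c0 cx.
have : ((c / 16)%:E <= Rcc nrm T)%E.
  by apply: le_trans tc _; apply: ereal_sup_ubound; exists t.
rewrite leNgt => /negP; apply.
by rewrite mulrC EFinM lte_pdivlMl.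
Qed.

End UcRcc.

(** Reduces each implication to a comparison of the two right-hand quantities, for all three choices
    of [M] at once. *)
Lemma propP_le (X : completeNormedModType K) (M Q Q' : quantity R X) (c : R) :
  0 < c ->
  (forall (Y : completeNormedModType K) (T : {linear X -> Y}), continuous T ->
    (Q Y T <= c%:E * Q' Y T)%E) ->
  propP M Q -> propP M Q'.
Proof.
move=> c0 QQ' [C [C0 MQ]]; exists (C * c); split; first exact: mulr_gt0.
move=> Y T Tc; rewrite EFinM -muleA; apply: le_trans (MQ Y T Tc) _.
by apply: lee_wpmul2l; [rewrite lee_fin ltW | exact: QQ'].
Qed.

Lemma propP_le1 (X : completeNormedModType K) (M Q Q' : quantity R X) :
  (forall (Y : completeNormedModType K) (T : X -> Y), (Q Y T <= Q' Y T)%E) ->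
  propP M Q -> propP M Q'.
Proof.
by move=> QQ'; apply: (propP_le ltr01) => Y T _; rewrite mul1e.
Qed.

Lemma ball_rho_cauchy_wcauchy (X : normedModType K) (x : nat -> X) :
  ball_seq nrm x /\ rho_cauchy nrm x -> ball_seq nrm x /\ wcauchy nrm x.
Proof. by move=> [? ?]; split=> //; exact: rho_cauchy_wcauchy. Qed.

Lemma theorem5p5_scalar_field : theorem5p5_statement nrm.
Proof.
(* All implications but the first have this form: a comparison of the quantities of a sequence, an
   inclusion of the classes of sequences, or both. *)
have sup_mono (X Y : normedModType K) (d d' : (nat -> Y) -> \bar R)
    (S S' : set (nat -> X)) (T : X -> Y) :
    (forall y, (d y <= d' y)%E) -> S `<=` S' ->
    (ereal_sup [set d (T \o x) | x in S] <=
     ereal_sup [set d' (T \o x) | x in S'])%E.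
  move=> dd' SS'; apply: ge_ereal_sup => _ [x Sx <-].
  apply: le_trans (dd' _) _; apply: ereal_sup_ubound.
  by exists x => //; exact: SS'.
move=> m X P; rewrite /P {P}; do !split.
- by apply: (@propP_le _ _ _ _ 16) => // Y T; exact: uc_le_Rcc.
- by apply: propP_le1 => Y T; apply: (sup_mono X Y (@wstar_dist _ _ nrm Y)
    (fun y => omega nrm (range y))) => // y; exact: wstar_dist_le_omega.
- by apply: propP_le1 => Y T; apply: (sup_mono X Y (fun y => omega nrm (range y))
    (@ca _ _ nrm Y)) => // y; exact: omega_le_ca.
- by apply: propP_le1 => Y T; apply: (sup_mono X Y (@ca _ _ nrm Y)
    (@ca _ _ nrm Y)) => // x; exact: ball_rho_cauchy_wcauchy.
- by apply: propP_le1 => Y T; apply: (sup_mono X Y (@wstar_dist _ _ nrm Y)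
    (@wstar_dist _ _ nrm Y)) => // x; exact: ball_rho_cauchy_wcauchy.
- by apply: propP_le1 => Y T; apply: (sup_mono X Y (@wstar_dist _ _ nrm Y)
    (fun y => omega nrm (range y))) => // y; exact: wstar_dist_le_omega.
- by apply: propP_le1 => Y T; apply: (sup_mono X Y (fun y => omega nrm (range y))
    (@ca _ _ nrm Y)) => // y; exact: omega_le_ca.
- by apply: propP_le1 => Y T; apply: (sup_mono X Y (fun y => omega nrm (range y))
    (fun y => omega nrm (range y))) => // x; exact: ball_rho_cauchy_wcauchy.
Qed.

End ScalarField.

(** * The real and the complex field *)

Lemma real_scalar_field (R : realType) :
  scalar_field (K := R) (fun r : R => r) (idfun : {rmorphism R -> R}).
Proof.
split=> //.
  move=> c; exists [set` `[- c, c]]; first exact: segment_compact.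
  by move=> z; rewrite /= in_itv/= ler_norml.
move=> V p pD pZ v.
have [|f [fD fZ fp fv]] := @real_hahn_banach R R idfun V p v.
  split=> // r x r0; apply: le_trans (pZ r x) _.
  by rewrite gtr0_norm.
have fle x : `|f x| <= p x.
  rewrite ler_norml fp andbT lerNl; have := fp (- x).
  have := fZ (-1) x; rewrite /= scaleN1r mulN1r => -> /le_trans; apply.
  by have := pZ (-1) x; rewrite scaleN1r normrN1 mul1r.
exists f; split=> //; first by move=> a x y; rewrite fD fZ.
by apply/eqP; rewrite eq_le fle/= -fv ler_norm.
Qed.

Section ComplexScalars.
Variable R : realType.
Local Open Scope complex_scope.

Lemma Re_norm_ge (z : R[i]) : `|complex.Re z| <= complex.Re `|z|.
Proof. by have := normc_ge_Re z; rewrite lecE => /andP[]. Qed.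

Lemma Im_norm_ge (z : R[i]) : `|complex.Im z| <= complex.Re `|z|.
Proof.
rewrite normc_def/= -sqrtr_sqr ler_wsqrtr//.
by rewrite lerDr sqr_ge0.
Qed.

Lemma Re_normK (x : R[i]) : 0 <= x -> (complex.Re x)%:C = x.
Proof. by move=> x0; rewrite RRe_real// ger0_real. Qed.

(** The ball lies in a square, the continuous image of a product of two segments. *)
Lemma complex_ball_compact (c : R) : exists2 A : set (R[i] : numFieldType), compact A &
  forall z, complex.Re `|z| <= c -> A z.
Proof.
pose g (ab : R * R) : (R[i] : numFieldType) := ab.1%:C + 'i * ab.2%:C.
have Cc : continuous (fun r : R => r%:C : (R[i] : numFieldType)).
  move=> r; apply/cvgrPdist_lt => e e0.
  have e0' : 0 < complex.Re e by move: e0; rewrite ltcE => /andP[].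
  have /cvgrPdist_lt/(_ _ e0') := @cvg_id _ (nbhs r).
  apply: filterS => s rs.
  by rewrite -rmorphB -[e](Re_normK (ltW e0)) normc_def/= expr0n addr0 sqrtr_sqr ltcR.
exists (g @` ([set` `[- c, c]] `*` [set` `[- c, c]])).
  apply: continuous_compact; last by apply: compact_setX; exact: segment_compact.
  apply: continuous_subspaceT => ab; apply: cvgD.
    by apply: continuous_comp; [exact: cvg_fst | exact: Cc].
  apply: cvgM; first exact: cvg_cst.
  by apply: continuous_comp; [exact: cvg_snd | exact: Cc].
move=> z zc; exists (complex.Re z, complex.Im z); last by rewrite /g/= -complexE.
by split=> /=; rewrite in_itv/= -ler_norml (le_trans _ zc) ?Re_norm_ge ?Im_norm_ge.
Qed.

Lemma complex_hahn_banach (V : normedModType R[i]) (p : V -> R) :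
  (forall x y, p (x + y) <= p x + p y) ->
  (forall a x, p (a *: x) <= complex.Re `|a| * p x) ->
  forall v, exists f : V -> R[i], [/\ lin_functional f,
    forall x, complex.Re `|f x| <= p x & complex.Re `|f v| = p v].
Proof.
move=> pD pZ v.
have [|f [fD fZ fp fv]] := @real_hahn_banach R R[i] (real_complex R) V p v.
  split=> // r x r0; apply: le_trans (pZ _ x) _.
  by rewrite normc_def/= expr0n addr0 sqrtr_sqr gtr0_norm.
(* The complex-linear functional with real part [f]. *)
pose F x : R[i] := f x +i* (- f ('i *: x)).
have fC a x : f (a *: x) = complex.Re a * f x + complex.Im a * f ('i *: x).
  by rewrite [in LHS](complexE a) scalerDl fD fZ (mulrC 'i) -scalerA fZ.
have fii x : f ('i *: ('i *: x)) = - f x.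
  have := fZ (-1) x; rewrite rmorphN rmorph1 scaleN1r mulN1r => <-.
  by rewrite scalerA -expr2 sqr_i scaleN1r.
have FL : lin_functional F.
  move=> a x y; rewrite /F scalerDr !fD.
  have -> : 'i *: (a *: x) = a *: ('i *: x) by rewrite !scalerA mulrC.
  rewrite (fC a x) (fC a ('i *: x)) fii; case: a => a b /=.
  have -> : (a +i* b) * (f x +i* - f ('i *: x)) + (f y +i* - f ('i *: y)) =
    (a * f x - b * - f ('i *: x) + f y) +i*
    (a * - f ('i *: x) + b * f x + - f ('i *: y)) by [].
  by congr (_ +i* _); ring.
have F_le x : complex.Re `|F x| <= p x.
  (* Rotation by a unimodular [u] makes the value at [u *: x] real and equal to the modulus of
     [F x], so the bound on the real part suffices. *)
  have [u [u1 uF]] : exists u : R[i], `|u| = 1 /\ u * F x = `|F x|.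
    have [Fx0|Fx0] := eqVneq (F x) 0.
      by exists 1; rewrite normr1 Fx0 mulr0 normr0.
    exists (`|F x| / F x); rewrite divfK//; split=> //.
    by rewrite normf_div normr_id divff// normr_eq0.
  rewrite -uF -lin_functionalZ//.
  by have := pZ u x; rewrite u1/= mul1r; exact: le_trans (fp _).
exists F; split=> //; apply/eqP; rewrite eq_le F_le/= -fv.
exact: le_trans (ler_norm _) (Re_norm_ge (F v)).
Qed.

End ComplexScalars.

Lemma complex_scalar_field (R : realType) :
  scalar_field (K := R[i]) (fun z : R[i] => complex.Re z)
    (real_complex R : {rmorphism R -> R[i]}).
Proof.
split.
- by move=> [a b] [c d].
- by move=> x; rewrite lecE => /andP[].
- by [].
- by move=> x /Re_normK.
- by move=> r; rewrite ler0c.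
- exact: complex_ball_compact.
- exact: complex_hahn_banach.
Qed.

(* real scalars (K = R, nrm = id) and complex scalars (K = R[i], nrm = Re) *)
Theorem theorem5p5 (R : realType) :
  theorem5p5_statement (K := R) (fun r : R => r) /\
  theorem5p5_statement (K := R[i]) (fun z : R[i] => complex.Re z).
Proof.
split.
  exact: theorem5p5_scalar_field (real_scalar_field R).
exact: theorem5p5_scalar_field (complex_scalar_field R).
Qed.
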